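(* Let $D$ be a domain in $\mathbb{R}^d$. Assume there exist points $p\in\partial D$, $q\in D$ and a sequence $(\varphi_j)$ of projective automorphisms of $D$ such that $\varphi_j(q)\to p$. If $p$ is a strictly convex boundary point of $D$, then $D$ is projectively equivalent to the unit ball.
   Context: $\mathbb{R}^d$ is embedded in $\mathbb{P}\mathbb{R}^d$ as the points $(1:x_1:\dots:x_d)$; a projective map is a map induced by a linear map of $\mathbb{R}^{d+1}$ acting on homogeneous coordinates (a linear-fractional map on $\mathbb{R}^d$). A projective automorphism of $D$ is a bijective projective map of $D$ onto itself; $D$ is projectively equivalent to the unit ball if some projective map sends $D$ bijectively onto the open unit ball. A point $p\in\partial D$ is strictly convex if $\partial D$ is $\mathcal{C}^2$-smooth in a neighborhood of $p$ and the restriction to the tangent hyperplane at $p$ of the Hessian of a (local) defining function is positive definite. *)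

(* Defs.v *)
From HB Require Import structures.
From mathcomp Require Import all_boot all_order all_algebra.
From mathcomp Require Import all_classical all_reals all_analysis.
Set Implicit Arguments. Unset Strict Implicit. Unset Printing Implicit Defensive.
Import Order.TTheory GRing.Theory Num.Theory.
Import numFieldNormedType.Exports.
Local Open Scope classical_set_scope.
Local Open Scope ring_scope.

Section Defs.
Variables (R : realType) (d : nat).

Definition homog (x : 'rV[R]_d) : 'rV[R]_(1 + d) := row_mx (const_mx 1) x.

Definition lin_img (A : 'M[R]_(1 + d)) (x : 'rV[R]_d) : 'rV[R]_(1 + d) :=
  homog x *m A.

Definition proj_defined (A : 'M[R]_(1 + d)) (x : 'rV[R]_d) : Prop :=
  lsubmx (lin_img A x) 0 0 != 0.

Definition proj_map (A : 'M[R]_(1 + d)) (x : 'rV[R]_d) : 'rV[R]_d :=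
  (lsubmx (lin_img A x) 0 0)^-1 *: rsubmx (lin_img A x).

Definition proj_bij_onto (A : 'M[R]_(1 + d)) (D E : set 'rV[R]_d) : Prop :=
  [/\ (forall x, D x -> proj_defined A x),
      (forall x, D x -> E (proj_map A x)),
      {in D &, injective (proj_map A)} &
      (forall y, E y -> exists2 x, D x & proj_map A x = y)].

Definition proj_aut (D : set 'rV[R]_d) (A : 'M[R]_(1 + d)) : Prop :=
  proj_bij_onto A D D.

Definition unit_ball : set 'rV[R]_d := [set x | \sum_i (x 0 i) ^+ 2 < 1].

Definition proj_equiv_ball (D : set 'rV[R]_d) : Prop :=
  exists A : 'M[R]_(1 + d), proj_bij_onto A D unit_ball.

Definition domain (D : set 'rV[R]_d) : Prop :=
  [/\ open D, connected D & D !=set0].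

Definition boundary (D : set 'rV[R]_d) : set 'rV[R]_d :=
  closure D `\` interior D.

Definition evec (i : 'I_d) : 'rV[R]_d := delta_mx 0 i.

Definition pd (i : 'I_d) (f : 'rV[R]_d -> R) : 'rV[R]_d -> R :=
  fun x => 'D_(evec i) f x.

Definition C2_on (U : set 'rV[R]_d) (f : 'rV[R]_d -> R) : Prop :=
  [/\ {within U, continuous f},
      (forall i x, U x -> derivable f x (evec i)),
      (forall i, {within U, continuous (pd i f)}),
      (forall i j x, U x -> derivable (pd j f) x (evec i)) &
      (forall i j, {within U, continuous (pd i (pd j f))})].

Definition local_defining_fun (D : set 'rV[R]_d) (p : 'rV[R]_d)
    (U : set 'rV[R]_d) (rho : 'rV[R]_d -> R) : Prop :=
  [/\ open U, U p, C2_on U rho,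
      D `&` U = [set x | U x /\ rho x < 0] &
      (forall x, U x -> exists i, pd i rho x != 0)].

Definition strictly_convex_point (D : set 'rV[R]_d) (p : 'rV[R]_d) : Prop :=
  boundary D p /\
  exists U rho, local_defining_fun D p U rho /\
    forall v : 'rV[R]_d, v != 0 ->
      \sum_i v 0 i * pd i rho p = 0 ->
      0 < \sum_i \sum_j v 0 i * v 0 j * pd i (pd j rho) p.

End Defs.

(* Main.v *)
(* A segment centred at a point z of D near p and contained in D is short,
   by strict convexity; a segment in D centred at q is mapped by phi_j to a
   segment through phi_j(q) of comparable size on both sides, so phi_j(x) -> p
   for x near q, and then for all x in D by connectedness.
   Put Q_j = phi_j(q), lam_j = -rho(Q_j) and pull back by phi_j the second Taylor
   polynomial of rho at Q_j, divided by lam_j.  Strict convexity bounds these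
   quadratic forms in homogeneous coordinates; a limit S along an ultrafilter
   satisfies S(q) = -1, S <= 0 on D, and conversely every vector with S < 0
   represents a point of D.  Expanding, S = -b^2 + P with b linear, b(q) = 1, and
   P semidefinite with P(q) = 0; a further degenerate direction of P would give
   an affine line contained in D, hence lines in D through points near p, which
   is impossible.  Thus D is the ellipsoid {S < 0}, and writing P as a sum of d
   squares c_i^2 makes x |-> (c_i(x) / b(x)) a projective map of D onto the ball. *)

Require Import Defs.
From HB Require Import structures.
From mathcomp Require Import all_boot all_order all_algebra.
From mathcomp Require Import all_classical all_reals all_analysis.
From mathcomp Require Import ring lra.
Import Order.TTheory GRing.Theory Num.Theory.
Import numFieldNormedType.Exports.
Local Open Scope classical_set_scope.
Local Open Scope ring_scope.
Set Implicit Arguments.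
Unset Strict Implicit.
Unset Printing Implicit Defensive.

(** * Partial derivatives *)

Lemma coord_le_norm (R : realType) (m : nat) (x : 'rV[R]_m) (i : 'I_m) :
  `|x 0 i| <= `|x|.
Proof.
rewrite [leRHS]/Num.norm/= mx_normrE.
by apply/bigmax_geP; right; exists (0, i).
Qed.

Lemma rV_norm_le (R : realType) (m : nat) (x : 'rV[R]_m) (e : R) :
  0 <= e -> (forall i, `|x 0 i| <= e) -> `|x| <= e.
Proof.
move=> e0 xe; rewrite /Num.norm/= mx_normrE; apply: bigmax_le => // -[i j] _ /=.
by rewrite ord1.
Qed.

Lemma rV_norm_lt (R : realType) (m : nat) (x : 'rV[R]_m) (e : R) :
  0 < e -> (forall i, `|x 0 i| < e) -> `|x| < e.
Proof.
move=> e0 xe; rewrite /Num.norm/= mx_normrE; apply: bigmax_lt => // -[i j] _ /=.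
by rewrite ord1.
Qed.

Section line.
Variables (R : realType) (d : nat) (f : 'rV[R]_d -> R).

Lemma is_derive_line (x v : 'rV[R]_d) (a t : R) :
  derivable f (x + (t * a) *: v) v ->
  is_derive t 1 (fun s : R => f (x + (s * a) *: v))
    (a * 'D_v f (x + (t * a) *: v)).
Proof.
move=> df.
pose F (s : R) := f (x + s *: v).
have dF : is_derive (t * a) (1 : R) F ('D_v f (x + (t * a) *: v)).
  have E : (fun h : R => h^-1 *: ((F \o shift (t * a)) (h *: 1) - F (t * a))) =
           (fun h => h^-1 *: ((f \o shift (x + (t * a) *: v)) (h *: v) -
                     f (x + (t * a) *: v))).
    apply/funext => h /=; rewrite /F; congr (_ *: (f _ - _)).
    by rewrite scalerDl [_ *: 1]mulr1 addrCA addrA.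
  by split; rewrite /derivable /derive E.
have -> : (fun s : R => f (x + (s * a) *: v)) = F \o (fun s => s * a) by [].
have dm : is_derive t (1:R) (fun s => s * a) a.
  have H := @is_deriveM _ _ id (cst a) t 1 1 0
    (is_derive_id _ _) (is_derive_cst _ _ _).
  by apply: is_derive_eq H _; rewrite scaler0 add0r [LHS]mulr1.
have := @is_derive1_comp R F (fun s => s * a) t _ _ dF dm.
by rewrite mulrC.
Qed.

Lemma mvt_line (x w : 'rV[R]_d) (df : R -> R) :
  (forall t : R, 0 <= t <= 1 ->
    is_derive t 1 (fun s : R => f (x + s *: w)) (df t)) ->
  exists2 t : R, 0 <= t <= 1 & f (x + w) - f x = df t.
Proof.
move=> H.
have [||t] := @MVT_segment R (fun s => f (x + s *: w)) df 0 1 ler01.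
- by move=> t; rewrite in_itv/= => /andP[t0 t1]; apply: H; rewrite !ltW.
- apply: derivable_within_continuous => t; rewrite in_itv/= => /H dt.
  exact: ex_derive.
- rewrite in_itv/= scale1r scale0r addr0 subr0 mulr1 => t01 E.
  by exists t.
Qed.

End line.

Section partials.
Variables (R : realType) (d : nat) (f : 'rV[R]_d -> R).

(* The segment from x to x + v is replaced by a path parallel to the axes,
   which stays in a sup-norm ball. *)
Lemma partial_increment (p : 'rV[R]_d) (r : R) (c : 'I_d -> R) (e : R) :
  (forall i (x : 'rV[R]_d), `|x - p| < r -> derivable f x (evec R i)) ->
  (forall i (x : 'rV[R]_d), `|x - p| < r -> `|pd i f x - c i| <= e) ->
  forall x v : 'rV[R]_d, `|x - p| < r -> `|x + v - p| < r ->
  `|f (x + v) - f x - \sum_i v 0 i * c i| <= d%:R * (e * `|v|).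
Proof.
move=> df ce x v xr xvr.
have r0 : 0 < r by apply: le_lt_trans xr.
pose X (k : nat) : 'rV[R]_d := \row_i (x 0 i + if (i < k)%N then v 0 i else 0).
have X0 : X 0%N = x by apply/rowP => i; rewrite mxE ltn0 addr0.
have Xd : X d = x + v by apply/rowP => i; rewrite !mxE ltn_ord.
have XS (k : 'I_d) : X k.+1 = X k + v 0 k *: evec R k.
  apply/rowP => i; rewrite !mxE ltnS eqxx /=; have [->|ik] := eqVneq i k.
    by rewrite leqnn ltnn addr0 mulr1.
  by rewrite mulr0 addr0 leq_eqVlt val_eqE (negbTE ik).
have Xin (k : 'I_d) t : 0 <= t <= 1 ->
    `|X k + (t * v 0 k) *: evec R k - p| < r.
  move=> /andP[t0 t1]; apply: rV_norm_lt => // i.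
  have h0 : `|x 0 i - p 0 i| < r.
    by have := coord_le_norm (x - p) i; rewrite !mxE => /le_lt_trans; apply.
  have h1 : `|x 0 i + v 0 i - p 0 i| < r.
    by have := coord_le_norm (x + v - p) i; rewrite !mxE => /le_lt_trans; apply.
  rewrite !mxE eqxx /=; have [ik|ik] := eqVneq i k.
    rewrite -ik ltnn mulr1 addr0.
    (* The bound by [r] is strict: at [t = 0] this comes from [h0], and for [t > 0] from the
       endpoint [x + v], weighted by [t]. *)
    move: t0; rewrite le_eqVlt => /orP[/eqP <-|t0]; first by rewrite mul0r addr0.
    have : t * `|x 0 i + v 0 i - p 0 i| < t * r by rewrite ltr_pM2l.
    have : (1 - t) * `|x 0 i - p 0 i| <= (1 - t) * r.
      by apply: ler_wpM2l; [rewrite subr_ge0|exact: ltW].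
    have -> : x 0 i + t * v 0 i - p 0 i =
        (1 - t) * (x 0 i - p 0 i) + t * (x 0 i + v 0 i - p 0 i) by ring.
    move=> Ha Hb; apply: le_lt_trans (ler_normD _ _) _.
    have t1' : 0 <= 1 - t by rewrite subr_ge0.
    rewrite !normrM (ger0_norm (ltW t0)) (ger0_norm t1'); lra.
  by rewrite mulr0 addr0; case: ifP => _; rewrite ?addr0.
have -> : f (x + v) - f x = \sum_(k < d) (f (X k.+1) - f (X k)).
  rewrite -(big_mkord xpredT (fun k => f (X k.+1) - f (X k))) telescope_sumr //.
  by rewrite X0 Xd.
rewrite -sumrB (le_trans (ler_norm_sum _ _ _)) //.
have -> : d%:R * (e * `|v|) = \sum_(k < d) (e * `|v|).
  by rewrite sumr_const card_ord mulr_natl.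
apply: ler_sum => k _; rewrite XS.
have [|t t01 ->] := @mvt_line R d f (X k) (v 0 k *: evec R k)
    (fun t => v 0 k * pd k f (X k + (t * v 0 k) *: evec R k)).
  move=> t t01.
  have := @is_derive_line R d f (X k) (evec R k) (v 0 k) t.
  under [X in is_derive _ _ X _]eq_fun do rewrite -scalerA.
  by apply; apply: df; exact: Xin.
rewrite -mulrBr normrM mulrC ler_pM //; first by apply: ce; exact: Xin.
exact: coord_le_norm.
Qed.

(** [C2_on] speaks only of axis directions. Continuity of the partials at [x] makes the error in
    [partial_increment], taken with [c i = pd i f x], of order [o(h)], which gives every
    direction. *)
Lemma derivable_partials (x : 'rV[R]_d) (r : R) :
  0 < r ->
  (forall i (y : 'rV[R]_d), `|y - x| < r -> derivable f y (evec R i)) ->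
  (forall i, {for x, continuous (pd i f)}) ->
  forall v, derivable f x v /\ 'D_v f x = \sum_i v 0 i * pd i f x.
Proof.
move=> r0 df cf v; set l := \sum_i _.
suff H : h^-1 *: ((f \o shift x) (h *: v) - f x) @[h --> 0^'] --> l.
  by split; [exact: cvgP H|exact: cvg_lim H].
apply/cvgrPdist_le => e e0.
pose e' := e / (d%:R * `|v| + 1).
have K0 : 0 < d%:R * `|v| + 1 by rewrite ltr_wpDl // mulr_ge0.
have e'0 : 0 < e' by rewrite divr_gt0.
have : \forall y \near x, forall i, `|pd i f x - pd i f y| <= e'.
  apply: (@filter_forall _ _ (fun i y => `|pd i f x - pd i f y| <= e')
    (nbhs x) _) => i.
  by have /cvgrPdist_le := cf i; apply.
move=> /nbhs_normP[s /= s0 sP].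
pose m := Num.min r s.
have m0 : 0 < m by rewrite lt_min r0.
near=> h.
have h0 : h != 0 by near: h; exact: nbhs_dnbhs_neq.
have hm : `|h *: v| < m.
  have h1 : `|h| * (`|v| + 1) < m.
    rewrite -ltr_pdivlMr ?ltr_wpDl //.
    near: h; apply: dnbhs0_lt; rewrite divr_gt0 // ltr_wpDl //.
  by rewrite normrZ (le_lt_trans _ h1) // ler_wpM2l // lerDl.
have /= := @partial_increment x m (fun i => pd i f x) e' _ _ x (h *: v) _ _.
have -> : \sum_i (h *: v) 0 i * pd i f x = h * l.
  by rewrite mulr_sumr; apply: eq_bigr => i _; rewrite mxE mulrA.
move=> H.
have {H} : `|f (x + h *: v) - f x - h * l| <= d%:R * (e' * `|h *: v|).
  apply: H.
  - by move=> i y; rewrite lt_min => /andP[yr _]; exact: df.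
  - move=> i y; rewrite lt_min => /andP[_ ys]; rewrite distrC; apply: sP.
    by rewrite /= distrC.
  - by rewrite subrr normr0.
  - by rewrite addrAC subrr add0r.
rewrite normrZ => H.
have -> : l - h^-1 *: ((f \o shift x) (h *: v) - f x) =
    - (h^-1 * (f (x + h *: v) - f x - h * l)).
  rewrite /= [h *: v + x]addrC /GRing.scale /=.
  move: (f (x + h *: v)) (f x) => F1 F0; field.
  by [].
rewrite normrN normrM normfV ler_pdivrMl ?normr_gt0 //.
apply: le_trans H _.
have -> : d%:R * (e' * (`|h| * `|v|)) = `|h| * (e' * (d%:R * `|v|)) by ring.
rewrite ler_wpM2l // /e' mulrAC ler_pdivrMr // ler_wpM2l ?(ltW e0) //.
by rewrite lerDl.
Unshelve. all: by end_near. Qed.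

End partials.

(** * Second-order Taylor formula *)

Lemma cvg_sumr (R : realType) (T I : Type) (F : set_system T) (FF : Filter F)
    (r : seq I) (f : I -> T -> R) (l : I -> R) :
  (forall i, f i x @[x --> F] --> l i) ->
  \sum_(i <- r) f i x @[x --> F] --> \sum_(i <- r) l i.
Proof.
move=> fl; elim: r => [|i r IH].
  by under eq_fun do rewrite big_nil; rewrite big_nil; exact: cvg_cst.
by under eq_fun do rewrite big_cons; rewrite big_cons; apply: cvgD.
Qed.

(** * Linear and quadratic forms on row vectors *)

Section forms.
Variables (R : realType) (m : nat).
Implicit Types (u : 'cV[R]_m) (Q : 'M[R]_m) (v w : 'rV[R]_m).

Definition lf u v : R := (v *m u) 0 0.
Definition qf Q v : R := (v *m Q *m v^T) 0 0.

Lemma lfE u v : lf u v = \sum_i v 0 i * u i 0.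
Proof. by rewrite /lf mxE. Qed.

Lemma qfE Q v : qf Q v = \sum_i \sum_j v 0 i * v 0 j * Q i j.
Proof.
rewrite /qf mxE exchange_big; apply: eq_bigr => j _.
by rewrite !mxE mulr_suml; apply: eq_bigr => i _; rewrite mulrAC.
Qed.

Lemma lfZ u a v : lf u (a *: v) = a * lf u v.
Proof. by rewrite /lf -scalemxAl mxE. Qed.

Lemma lfN u v : lf u (- v) = - lf u v.
Proof. by rewrite /lf mulNmx mxE. Qed.

Lemma lf0 u : lf u 0 = 0.
Proof. by rewrite /lf mul0mx mxE. Qed.

Lemma lfZl a u v : lf (a *: u) v = a * lf u v.
Proof. by rewrite /lf -scalemxAr mxE. Qed.

Lemma lfBl u u' v : lf (u - u') v = lf u v - lf u' v.
Proof. by rewrite /lf mulmxBr !mxE. Qed.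

Lemma qfZ Q a v : qf Q (a *: v) = a ^+ 2 * qf Q v.
Proof. by rewrite /qf linearZ /= -!scalemxAl -scalemxAr scalerA mxE expr2. Qed.

Lemma lf_bound u e v : (forall i, `|u i 0| <= e) ->
  `|lf u v| <= m%:R * e * `|v|.
Proof.
move=> ue; rewrite lfE (le_trans (ler_norm_sum _ _ _)) //.
have -> : m%:R * e * `|v| = \sum_(i < m) (`|v| * e).
  by rewrite sumr_const card_ord -[RHS]mulr_natl mulrA mulrAC.
apply: ler_sum => i _; rewrite normrM ler_pM //; exact: coord_le_norm.
Qed.

Lemma lf_norm u : exists2 C, 0 <= C & forall v, `|lf u v| <= C * `|v|.
Proof.
exists (m%:R * `|u^T|) => [|v]; first by rewrite mulr_ge0.
by apply: lf_bound => i; have := coord_le_norm u^T i; rewrite mxE.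
Qed.

Lemma qf_norm Q : exists2 C, 0 <= C & forall v, `|qf Q v| <= C * `|v| ^+ 2.
Proof.
exists (\sum_i \sum_j `|Q i j|) => [|v].
  by apply: sumr_ge0 => i _; apply: sumr_ge0.
rewrite qfE mulr_suml (le_trans (ler_norm_sum _ _ _)) // ler_sum // => i _.
rewrite mulr_suml (le_trans (ler_norm_sum _ _ _)) // ler_sum // => j _.
by rewrite !normrM mulrC expr2 ler_wpM2l // ler_pM // coord_le_norm.
Qed.

Lemma continuous_lf u : continuous (lf u).
Proof.
have -> : lf u = (fun v => \sum_i v 0 i * u i 0) by apply/funext => v; rewrite lfE.
move=> v; apply: (@cvg_sumr _ _ _ (nbhs v)) => i.
by apply: cvgM; [exact: coord_continuous|exact: cvg_cst].
Qed.

Lemma continuous_qf Q : continuous (qf Q).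
Proof.
have -> : qf Q = (fun v => \sum_i \sum_j v 0 i * v 0 j * Q i j).
  by apply/funext => v; rewrite qfE.
move=> v; apply: (@cvg_sumr _ _ _ (nbhs v)) => i.
apply: (@cvg_sumr _ _ _ (nbhs v)) => j.
by apply: cvgM; [apply: cvgM; exact: coord_continuous|exact: cvg_cst].
Qed.

End forms.

Definition grad (R : realType) (d : nat) (rho : 'rV[R]_d -> R) (z : 'rV[R]_d) :
  'cV[R]_d := \col_i pd i rho z.

Definition hess (R : realType) (d : nat) (rho : 'rV[R]_d -> R) (p : 'rV[R]_d) :
  'M[R]_d := \matrix_(i, j) pd i (pd j rho) p.

Section taylor.
Variables (R : realType) (d : nat) (rho : 'rV[R]_d -> R) (U : set 'rV[R]_d).
Hypotheses (oU : open U) (C2 : C2_on U rho).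

Lemma open_norm_ball (p : 'rV[R]_d) : U p ->
  exists2 r : R, 0 < r & forall z : 'rV[R]_d, `|z - p| < r -> U z.
Proof.
move=> Up; have /nbhs_normP[r /= r0 H] : nbhs p U by exact: open_nbhs_nbhs.
by exists r => // z zp; apply: H; rewrite /= distrC.
Qed.

Lemma within_open_near (f : 'rV[R]_d -> R) (p : 'rV[R]_d) (e : R) :
  {within U, continuous f} -> U p -> 0 < e ->
  \forall x \near p, `|f x - f p| <= e.
Proof.
rewrite continuous_open_subspace // => cf Up e0.
have /cvgrPdist_le /(_ _ e0) := cf p (mem_set Up).
by apply: filterS => x; rewrite distrC.
Qed.

Lemma grad_near (p : 'rV[R]_d) (e : R) : U p -> 0 < e ->
  exists2 r : R, 0 < r & forall z v : 'rV[R]_d, `|z - p| < r ->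
    `|lf (grad rho z) v - lf (grad rho p) v| <= e * `|v|.
Proof.
move=> Up e0; have [_ _ cg _ _] := C2.
pose e' := e / (d%:R + 1).
have e'0 : 0 < e' by rewrite divr_gt0 // ltr_wpDl.
have /nbhs_normP[r /= r0 H] :
    \forall x \near p, forall i, `|pd i rho x - pd i rho p| <= e'.
  apply: (@filter_forall _ _ (fun i x => `|pd i rho x - pd i rho p| <= e')
    (nbhs p) _) => i.
  exact: within_open_near.
exists r => // z v zp; rewrite -lfBl.
apply: le_trans (@lf_bound _ _ _ e' _ _) _.
  by move=> i; rewrite !mxE; apply: H; rewrite /= distrC.
rewrite ler_wpM2r // /e' mulrCA ler_piMr ?(ltW e0) //.
by rewrite ler_pdivrMr ?mul1r ?lerDl // ltr_wpDl.
Qed.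

Lemma derivable_C1 (f : 'rV[R]_d -> R) (x : 'rV[R]_d) :
  (forall i x, U x -> derivable f x (evec R i)) ->
  (forall i, {within U, continuous (pd i f)}) -> U x ->
  forall v, derivable f x v /\ 'D_v f x = lf (grad f x) v.
Proof.
move=> df cf Ux v; have [r r0 rU] := open_norm_ball Ux.
have [| |? ->] := @derivable_partials R d f x r r0 _ _ v.
- by move=> i y yr; exact/df/rU.
- move=> i; have := cf i; rewrite continuous_open_subspace //.
  by apply; exact: mem_set.
- by split=> //; rewrite lfE; apply: eq_bigr => i _; rewrite mxE.
Qed.

(** The gradient sits at the moving point [z] but the Hessian at [p], so that a single quadratic
    form serves all base points near [p]. The mean value theorem for [psi] reduces the remainder to
    increments of the first partials, to which [partial_increment] applies. *)
Lemma taylor2 (p : 'rV[R]_d) (e : R) : U p -> 0 < e ->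
  exists2 r : R, 0 < r & forall z v : 'rV[R]_d,
    `|z - p| < r -> `|z + v - p| < r ->
    `|rho (z + v) - rho z - lf (grad rho z) v - qf (hess rho p) v / 2|
      <= e * `|v| ^+ 2.
Proof.
move=> Up e0; have [_ d1 c1 d2 c2] := C2.
(* One factor [d] comes from the sum over [j], the other from [partial_increment]; the [+ 1] covers
   [d = 0]. *)
pose e' := e / (d%:R * d%:R + 1).
have K0 : 0 < d%:R * d%:R + 1 :> R by rewrite ltr_wpDl // mulr_ge0.
have e'0 : 0 < e' by rewrite divr_gt0.
have [r1 r10 r1U] := open_norm_ball Up.
have /nbhs_normP[r2 /= r20 H] : \forall x \near p, forall ij : 'I_d * 'I_d,
    `|pd ij.1 (pd ij.2 rho) x - pd ij.1 (pd ij.2 rho) p| <= e'.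
  apply: (@filter_forall _ _ (fun ij x =>
    `|pd ij.1 (pd ij.2 rho) x - pd ij.1 (pd ij.2 rho) p| <= e')
    (nbhs p) _) => ij.
  exact: within_open_near.
pose r := Num.min r1 r2.
exists r => [|z v zr zvr]; first by rewrite lt_min r10.
have seg (t : R) : 0 <= t <= 1 -> `|z + t *: v - p| < r.
  move=> /andP[t0 t1].
  have -> : z + t *: v - p = (1 - t) *: (z - p) + t *: (z + v - p).
    by apply/rowP => i; rewrite !mxE; ring.
  rewrite (le_lt_trans (ler_normD _ _)) // !normrZ (ger0_norm t0).
  rewrite ger0_norm ?subr_ge0 //.
  move: zr zvr => /=; move: `|z - p| `|z + v - p| => a b ar br.
  have [t0'|t0'] := leP t (1/2); nra.
set A := lf (grad rho z) v; set B := qf (hess rho p) v.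
pose psi : R -> R := (fun s => rho (z + s *: v)) - (A \*: id + (B / 2) \*: id ^+ 2).
have dpsi (t : R) : 0 <= t <= 1 ->
    is_derive t 1 psi (lf (grad rho (z + t *: v)) v - (A + t * B)).
  move=> t01; have Uz : U (z + t *: v).
    by apply: r1U; apply: lt_le_trans (seg t t01) _; rewrite ge_min lexx.
  have [dr Dr] := derivable_C1 d1 c1 Uz v.
  have Hl : is_derive t 1 (fun s => rho (z + s *: v)) (lf (grad rho (z + t *: v)) v).
    have := @is_derive_line R d rho z v 1 t; rewrite mulr1 mul1r Dr => /(_ dr).
    by under [X in is_derive _ _ X _]eq_fun do rewrite mulr1.
  apply: is_derive_eq.
  by rewrite /GRing.scale /= !mulr1; field.
have [||t t01] := @MVT_segment R psi
    (fun t => lf (grad rho (z + t *: v)) v - (A + t * B)) 0 1 ler01.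
- by move=> t; rewrite in_itv/= => /andP[t0 t1]; apply: dpsi; rewrite !ltW.
- apply: derivable_within_continuous => t; rewrite in_itv/= => /dpsi dt.
  exact: ex_derive.
have psiE (s : R) : psi s = rho (z + s *: v) - (A * s + B / 2 * s ^+ 2).
  by rewrite /psi !fctE /GRing.scale.
rewrite !psiE scale1r scale0r addr0 subr0.
move=> E.
have -> : rho (z + v) - rho z - A - B / 2 =
    lf (grad rho (z + t *: v)) v - (A + t * B).
  by rewrite -[RHS]mulr1 -E; field.
have -> : lf (grad rho (z + t *: v)) v - (A + t * B) =
    \sum_j v 0 j * (pd j rho (z + t *: v) - pd j rho z -
      \sum_i (t *: v) 0 i * hess rho p i j).
  rewrite /A /B !lfE qfE exchange_big mulr_sumr opprD addrA -!sumrB.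
  apply: eq_bigr => j _; rewrite !mxE !mulrBr; congr (_ - _).
  by rewrite !mulr_sumr; apply: eq_bigr => i _; rewrite !mxE; ring.
rewrite in_itv /= in t01.
apply: (@le_trans _ _ (\sum_(j < d) `|v| * (d%:R * (e' * `|v|)))).
  rewrite (le_trans (ler_norm_sum _ _ _)) // ler_sum // => j _.
  rewrite normrM ler_pM //; first exact: coord_le_norm.
  apply: le_trans (@partial_increment R d (pd j rho) p r
    (fun i => hess rho p i j) e' _ _ z (t *: v) zr (seg t t01)) _.
  - by move=> i x xr; apply: d2; apply: r1U; apply: lt_le_trans xr _;
      rewrite ge_min lexx.
  - move=> i x xr; rewrite mxE; apply: (H _ _ (i, j)); rewrite /= distrC.
    by apply: lt_le_trans xr _; rewrite ge_min lexx orbT.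
  rewrite ler_wpM2l // ler_wpM2l ?(ltW e'0) // normrZ ler_piMl //.
  by move: t01 => /andP[t0 t1]; rewrite ger0_norm.
rewrite sumr_const card_ord -[leLHS]mulr_natl.
have -> : d%:R * (`|v| * (d%:R * (e' * `|v|))) =
  e' * (d%:R * d%:R) * `|v| ^+ 2 by ring.
rewrite ler_wpM2r ?exprn_ge0 // /e' mulrAC ler_pdivrMr //.
by rewrite ler_wpM2l ?(ltW e0) // lerDl.
Qed.

End taylor.

(** * Local geometry at a strictly convex boundary point *)

Section ultra.
Variables (R : realType) (T : Type) (G : set_system T) (GU : UltraFilter G).

Lemma ultra_bounded_cvg (f : T -> R) (C : R) :
  (\forall x \near G, `|f x| <= C) -> exists l : R, f x @[x --> G] --> l.
Proof.
move=> fC.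
have := @segment_compact R (- C) C; rewrite compact_ultra.
have fU : UltraFilter (f @ G).
  split; first exact: fmap_proper_filter.
  move=> H HP GH; apply/seteqP; split => // A HA.
  have [//|GA] := in_ultra_setVsetC (f @^-1` A) GU.
  have /(filterI HA) : H (~` A) by exact: GH.
  by rewrite setICr => /filter_not_empty.
case/(_ _ fU) => [|l [_ fl]]; last by exists l.
by apply: filterS fC => x; rewrite /= in_itv /= ler_norml.
Qed.

End ultra.

Lemma rV_cvg (R : realType) (T : Type) (F : set_system T) (FF : Filter F)
    (m : nat) (f : T -> 'rV[R]_m) (l : 'rV[R]_m) :
  (forall i, f x 0 i @[x --> F] --> l 0 i) -> f x @[x --> F] --> l.
Proof.
move=> fl; apply/cvgrPdist_le => e e0.
have : \forall x \near F, forall i, `|l 0 i - f x 0 i| <= e.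
  apply: (@filter_forall _ _ (fun i x => `|l 0 i - f x 0 i| <= e) F _) => i.
  by have /cvgrPdist_le := fl i; apply.
apply: filterS => x fx; apply: rV_norm_le; first exact: ltW.
by move=> i; rewrite !mxE.
Qed.

(** Bounds on the images of the unit vectors bound every entry, so each entry converges along the
    ultrafilter. This takes the place of extracting a convergent subsequence. *)
Lemma ultra_mulmx_cvg (R : realType) (T : Type) (G : set_system T)
    (GU : UltraFilter G) (m n : nat) (F : T -> 'M[R]_(m, n)) :
  (forall v : 'rV[R]_m, exists C, \forall x \near G, `|v *m F x| <= C) ->
  exists L : 'M[R]_(m, n), forall v : 'rV[R]_m, v *m F x @[x --> G] --> v *m L.
Proof.
move=> FC.
have H (ij : 'I_m * 'I_n) : exists l : R, F x ij.1 ij.2 @[x --> G] --> l.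
  have [C HC] := FC (delta_mx 0 ij.1).
  apply: (@ultra_bounded_cvg _ _ _ _ _ C); apply: filterS HC => x.
  by apply: le_trans; rewrite -rowE; have := coord_le_norm (row ij.1 (F x)) ij.2;
    rewrite mxE.
have [l Hl] := choice H.
exists (\matrix_(i, j) l (i, j)) => v; apply: rV_cvg => j.
under eq_fun do rewrite mxE; rewrite mxE.
apply: cvg_sumr => i; rewrite mxE; apply: cvgM; first exact: cvg_cst.
exact: Hl (i, j).
Qed.

(** Compactness of the unit sphere: if no penalty weight works, unit vectors violating the bound for
    each [n.+1] have a limit [l] with [lf g l = 0] and [qf Q l <= 0]. Homogeneity then extends the
    bound from the sphere to all [v]. *)
Lemma finsler (R : realType) (m : nat) (Q : 'M[R]_m) (g : 'cV[R]_m) :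
  (forall v : 'rV[R]_m, v != 0 -> lf g v = 0 -> 0 < qf Q v) ->
  exists2 N : R, 0 < N & forall v, `|v| ^+ 2 / N <= qf Q v + N * lf g v ^+ 2.
Proof.
move=> Qg.
have [n Hn] : exists n : nat, forall v : 'rV[R]_m, `|v| = 1 ->
    n.+1%:R^-1 <= qf Q v + n.+1%:R * lf g v ^+ 2.
  apply: contrapT => /forallNP H.
  have {}H (n : nat) : exists v : 'rV[R]_m,
      `|v| = 1 /\ qf Q v + n.+1%:R * lf g v ^+ 2 < n.+1%:R^-1.
    have /existsNP[v /not_implyP[v1 Hv]] := H n.
    by exists v; split => //; rewrite ltNge; apply/negP.
  have [V HV] := choice H.
  have [G [GU sG]] := ultraFilterLemma (@eventually_filter : ProperFilter \oo).
  have V1 n : `|V n| = 1 by have [] := HV n.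
  have [l Vl] : exists l : 'rV[R]_m, V n @[n --> G] --> l.
    (* Each [V n] is read as a matrix with one row, so the multiplier [i] is a scalar. *)
    have [i|L HL] := @ultra_mulmx_cvg R nat G GU 1 m (fun n => V n).
      exists `|i 0 0|; near=> n.
      by rewrite [X in X *m _]mx11_scalar mul_scalar_mx normrZ V1 mulr1.
    exists (1%:M *m L); have := HL 1%:M.
    by under eq_fun do rewrite mul1mx.
  have l1 : `|l| = 1.
    have /cvg_norm := Vl; under eq_fun do rewrite V1.
    by move=> H1; exact: (cvg_unique _ H1 (cvg_cst (1 : R))).
  have Vq : qf Q (V n) @[n --> G] --> qf Q l.
    by apply: continuous_cvg => //; exact: continuous_qf.
  have Vg : lf g (V n) @[n --> G] --> lf g l.
    by apply: continuous_cvg => //; exact: continuous_lf.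
  have inv0 : (n.+1%:R^-1 : R) @[n --> G] --> (0 : R).
    apply: cvg_trans (@cvg_harmonic R) => P; exact: sG.
  have [C C0 HC] := qf_norm Q.
  (* Since [qf Q (V n) >= - C] on the sphere, the violated inequality gives
     [lf g (V n) ^+ 2 <= (C + 1) / n.+1]. *)
  have lg0 : lf g l ^+ 2 <= 0.
    have Vg2 : lf g (V n) ^+ 2 @[n --> G] --> lf g l ^+ 2.
      by rewrite expr2; under eq_fun do rewrite expr2; exact: cvgM.
    have H0 : (n.+1%:R^-1 * (C + 1) : R) @[n --> G] --> 0 * (C + 1).
      by apply: cvgM => //; exact: cvg_cst.
    rewrite mul0r in H0; apply: ler_cvg_to Vg2 H0 _; near=> n.
    have [_ Hn] := HV n.
    have := HC (V n); rewrite V1 expr1n mulr1 ler_norml => /andP[Hq _].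
    have i1 : (n.+1%:R^-1 : R) <= 1 by rewrite invf_le1 // ler1n.
    rewrite ler_pdivlMl //; move: Hn Hq i1; move: (n.+1%:R : R) => K; lra.
  have lg : lf g l = 0.
    by apply/eqP; rewrite -sqrf_eq0 eq_le lg0 sqr_ge0.
  have : qf Q l <= 0.
    apply: ler_cvg_to Vq inv0 _; near=> n.
    have [_ Hn] := HV n; apply: le_trans _ (ltW Hn).
    by rewrite lerDl mulr_ge0 // sqr_ge0.
  rewrite leNgt Qg // -normr_eq0 l1; exact: oner_neq0.
exists n.+1%:R => // v.
have [->|v0] := eqVneq v 0.
  by rewrite normr0 expr0n mul0r lf0 /qf !mul0mx mxE expr0n mulr0 addr0.
have nv0 : 0 < `|v| by rewrite normr_gt0.
have -> : v = `|v| *: (`|v|^-1 *: v) by rewrite scalerA divff ?scale1r // gt_eqF.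
have := Hn (`|v|^-1 *: v).
rewrite normrZ ger0_norm ?invr_ge0 // mulVf ?gt_eqF // => /(_ erefl).
set w := _^-1 *: v => Hw.
have w1 : `|w| = 1 by rewrite normrZ ger0_norm ?invr_ge0 // mulVf // gt_eqF.
rewrite normrZ w1 mulr1 normr_id qfZ lfZ exprMn mulrCA -mulrDr ler_wpM2l //.
Unshelve. all: by end_near. Qed.

(** * Quantitative strict convexity near [p] *)

Section local_estimates.
Variables (R : realType) (d : nat) (rho : 'rV[R]_d -> R) (U D : set 'rV[R]_d).
Variable p : 'rV[R]_d.
Hypotheses (oU : open U) (Up : U p) (C2 : C2_on U rho).
Hypothesis DU : D `&` U = [set x | U x /\ rho x < 0].
Hypothesis convex_p : forall v : 'rV[R]_d, v != 0 -> lf (grad rho p) v = 0 ->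
  0 < qf (hess rho p) v.

Lemma D_near_p : exists2 r : R, 0 < r & forall z, `|z - p| < r ->
  (D z <-> rho z < 0).
Proof.
have [r r0 rU] := open_norm_ball oU Up.
exists r => // z /rU Uz.
have := congr1 (@^~ z) DU => /= E; split=> [Dz|rz].
  by have [] : U z /\ rho z < 0 by rewrite -E.
by have [] : D z /\ U z by rewrite E.
Qed.

(* With G = - grad rho(z) . y, the Taylor formula and Finsler's lemma give
   c |y|^2 <= - rho z + G + N G^2, which also forces G >= 2 rho z. *)
Lemma strictly_convex_estimate : exists c r : R, [/\ 0 < c, 0 < r &
  forall z y, `|z - p| < r -> `|z + y - p| < r -> D z -> D (z + y) ->
  c * `|y| ^+ 2 <= - 2 * rho z - lf (grad rho z) y].
Proof.
have [N N0 HN] := finsler convex_p.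
have [C C0 HC] := lf_norm (grad rho p).
have [r1 r10 Hr1] := D_near_p.
have e0 : 0 < (8 * N)^-1 by rewrite invr_gt0 mulr_gt0.
have [r2 r20 Hr2] := taylor2 oU C2 Up e0.
have del0 : 0 < (4 * N)^-1 by rewrite invr_gt0 mulr_gt0.
have [r3 r30 Hr3] := grad_near oU C2 Up del0.
(* [K] bounds [N * |G|] in units of [|y|]; two points within [(4 * K)^-1] of [p] differ by less than
   [(2 * K)^-1], whence [N * |G| <= 1 / 2], and the penalty [N * G ^+ 2] becomes at most
   [|G| / 2]. *)
pose K := N * (C + (4 * N)^-1).
have K0 : 0 < K by rewrite mulr_gt0 // ltr_wpDl.
have r40 : 0 < (4 * K)^-1 by rewrite invr_gt0 mulr_gt0.
pose r := Num.min (Num.min r1 r2) (Num.min r3 (4 * K)^-1).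
exists (8 * N)^-1, r; split => //; first by rewrite !lt_min r10 r20 r30.
move=> z y; rewrite !lt_min => /andP[/andP[z1 z2] /andP[z3 z4]].
move=> /andP[/andP[y1 y2] /andP[y3 y4]] /(Hr1 _ z1).1 Dz /(Hr1 _ y1).1 Dy.
have := Hr2 z y z2 y2; rewrite ler_norml => /andP[T1 _].
have F := HN y; have G1 := Hr3 z y z3.
set Y := `|y| in T1 F G1 *.
have Y0 : 0 <= Y by exact: normr_ge0.
have Yr : Y < (2 * K)^-1.
  have -> : (2 * K)^-1 = (4 * K)^-1 + (4 * K)^-1 by field; rewrite gt_eqF.
  have -> : Y = `|(z + y - p) - (z - p)|.
    by congr `|_|; apply/rowP => i; rewrite !mxE; ring.
  by rewrite (le_lt_trans (ler_normB _ _)) // ltrD.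
have G2 := HC y.
set G := lf (grad rho z) y in T1 G1 *; set G0 := lf (grad rho p) y in F G1 G2 *.
set H := qf (hess rho p) y in T1 F *.
have NG : N * `|G| <= 1 / 2.
  have : `|G| <= (C + (4 * N)^-1) * Y.
    have -> : G = (G - G0) + G0 by ring.
    by rewrite mulrDl addrC; apply: le_trans (ler_normD _ _) _; rewrite lerD.
  move=> /(ler_wpM2l (ltW N0)) /le_trans; apply.
  rewrite mulrA -/K; apply: (@le_trans _ _ (K * (2 * K)^-1)).
    by rewrite ler_wpM2l // ltW.
  by rewrite le_eqVlt; apply/orP; left; apply/eqP; field; rewrite gt_eqF.
have G0b : G0 ^+ 2 <= 2 * G ^+ 2 + 2 * ((4 * N)^-1 * Y) ^+ 2.
  have : (G - G0) ^+ 2 <= ((4 * N)^-1 * Y) ^+ 2.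
    by rewrite -real_normK ?num_real // lerXn2r // nnegrE mulr_ge0 // ltW.
  by have := sqr_ge0 (2 * G - G0); lra.
pose I := (8 * N)^-1.
have I0 : 0 < I by [].
have EN : (4 * N)^-1 = 2 * I by rewrite /I; field; rewrite gt_eqF.
have EN1 : N^-1 = 8 * I by rewrite /I; field; rewrite gt_eqF.
have NI : N * I = 1 / 8 by rewrite /I; field; rewrite gt_eqF.
rewrite EN in G0b; rewrite EN1 in F; rewrite -/I in T1 *.
have F2 : Y ^+ 2 * (8 * I) <= H + 2 * N * G ^+ 2 + I * Y ^+ 2.
  apply: le_trans F _; rewrite -addrA lerD2l.
  apply: le_trans (ler_wpM2l (ltW N0) G0b) _.
  have -> : N * (2 * G ^+ 2 + 2 * (2 * I * Y) ^+ 2) =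
    2 * N * G ^+ 2 + 8 * (N * I) * I * Y ^+ 2 by ring.
  by rewrite NI; lra.
have NG2 : N * G ^+ 2 <= `|G| / 2.
  have -> : G ^+ 2 = `|G| * `|G| by rewrite -expr2 real_normK ?num_real.
  rewrite mulrA [leRHS]mulrC ler_wpM2r //; lra.
have Y20 : 0 <= I * Y ^+ 2 by rewrite mulr_ge0 ?exprn_ge0 // ltW.
have key : 2 * (I * Y ^+ 2) <= - rho z - G + `|G| / 2 by lra.
(* For [G >= 0] the inequality [key] is multiplied by 2, for [G < 0] by 2/3; in the second case
   [rho z < 0] supplies the rest. *)
have [Gs|Gs] := leP 0 G.
  by rewrite ger0_norm // in key; lra.
by rewrite ltr0_norm // in key; lra.
Qed.

(** If [|w| > e], the estimate holds for the two opposite multiples of [w] of norm [e]; adding them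
    cancels the gradient term and leaves [c * e ^+ 2 <= - 2 * rho z]. *)
Lemma short_segments (c r : R) : 0 < c -> 0 < r ->
  (forall z y, `|z - p| < r -> `|z + y - p| < r -> D z -> D (z + y) ->
    c * `|y| ^+ 2 <= - 2 * rho z - lf (grad rho z) y) ->
  forall z w, `|z - p| < r / 2 -> D z ->
  (forall t : R, `|t| <= 1 -> D (z + t *: w)) ->
  forall e : R, 0 < e <= r / 2 -> - 2 * rho z < c * e ^+ 2 -> `|w| <= e.
Proof.
move=> c0 r0 est z w zp Dz seg e /andP[e0 er] rze.
rewrite leNgt; apply/negP => we.
have w0 : 0 < `|w| by exact: lt_trans we.
pose t := e / `|w|.
have t0 : 0 < t by rewrite divr_gt0.
have t1 : t <= 1 by rewrite ler_pdivrMr // mul1r ltW.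
have tw : `|t *: w| = e by rewrite normrZ gtr0_norm // divfK // gt_eqF.
have zr : `|z - p| < r by apply: lt_trans zp _; lra.
have near s : `|s| = t -> `|z + s *: w - p| < r.
  move=> st; rewrite addrAC (le_lt_trans (ler_normD _ _)) //.
  by rewrite normrZ st -(gtr0_norm t0) -normrZ tw; lra.
have H1 := est z (t *: w) zr (near t (gtr0_norm t0)) Dz (seg t _).
have H2 := est z ((- t) *: w) zr (near (- t) _) Dz (seg (- t) _).
have {}H1 : c * e ^+ 2 <= - 2 * rho z - t * lf (grad rho z) w.
  by rewrite -lfZ -tw; apply: H1; rewrite gtr0_norm.
have {}H2 : c * e ^+ 2 <= - 2 * rho z + t * lf (grad rho z) w.
  rewrite -[t * _]opprK -mulNr -lfZ -tw -normrN -scaleNr.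
  by apply: H2; rewrite normrN gtr0_norm.
lra.
Qed.

End local_estimates.

(** * Localization of the automorphisms *)

(** The denominator is normalized to 1 at [q]: [alpha] is then its linear part and [eta] the
    differential of the map at [q]. Subtracting the value at [q] over the common denominator
    produces the correction [alpha *m proj_map A q]. *)
Lemma proj_normal_form (R : realType) (d : nat) (A : 'M[R]_(1 + d)) (q : 'rV[R]_d) :
  proj_defined A q -> exists (alpha : 'cV[R]_d) (eta : 'M[R]_d), forall v,
    (proj_defined A (q + v) <-> 1 + lf alpha v != 0) /\
    (1 + lf alpha v != 0 -> proj_map A (q + v) =
      proj_map A q + (1 + lf alpha v)^-1 *: (v *m eta)).
Proof.
rewrite /proj_defined; set a := lsubmx _ 0 0 => a0.
pose alpha : 'cV[R]_d := a^-1 *: lsubmx (dsubmx A).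
pose eta : 'M[R]_d := a^-1 *: rsubmx (dsubmx A) - alpha *m proj_map A q.
exists alpha, eta => v.
have E : lin_img A (q + v) = lin_img A q + v *m dsubmx A.
  rewrite /lin_img /homog -{1}(addr0 (const_mx 1)) -add_row_mx mulmxDl.
  congr (_ + _); rewrite -{1}[A]vsubmxK mul_row_col mul0mx add0r.
  by [].
have El : lsubmx (lin_img A (q + v)) 0 0 = a * (1 + lf alpha v).
  rewrite E linearD /= mxE -/a -mulmx_lsub mulrDr mulr1; congr (_ + _).
  by rewrite /alpha lfZl mulrA mulfV // mul1r.
split; first by rewrite El mulf_eq0 (negbTE a0).
move=> b0; rewrite /proj_map El E linearD /= -[rsubmx (v *m _)]mulmx_rsub -/a.
rewrite /eta mulmxBr -scalemxAr mulmxA.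
have -> : v *m alpha = (lf alpha v)%:M by rewrite /lf -mx11_scalar.
rewrite mul_scalar_mx /proj_map -/a.
move: (rsubmx (lin_img A q)) (v *m rsubmx (dsubmx A)) (lf alpha v) b0 => x y l b0.
by apply/rowP => i; rewrite !mxE; field; rewrite a0 b0.
Qed.

Section localization.
Variables (R : realType) (d : nat) (D : set 'rV[R]_d) (p : 'rV[R]_d).
Variable phi : nat -> 'M[R]_(1 + d).
Hypothesis oD : open D.
Hypothesis aut : forall j, proj_aut D (phi j).
Hypothesis short : forall e : R, 0 < e -> exists2 r : R, 0 < r &
  forall z w : 'rV[R]_d, `|z - p| < r -> D z ->
    (forall t : R, `|t| <= 1 -> D (z + t *: w)) -> `|w| <= e.

(** Otherwise the multiple of [v] by [- (lf alpha v)^-1] stays in the ball and is a zero of the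
    denominator inside [D]. *)
Lemma aut_alpha_lt1 (A : 'M[R]_(1 + d)) (x : 'rV[R]_d) (alpha : 'cV[R]_d) (s : R) :
  proj_aut D A ->
  (forall v, proj_defined A (x + v) <-> 1 + lf alpha v != 0) ->
  (forall v : 'rV[R]_d, `|v| <= s -> D (x + v)) ->
  forall v : 'rV[R]_d, `|v| <= s -> `|lf alpha v| < 1.
Proof.
move=> [def _ _ _] Hdef sD v vs; rewrite ltNge; apply/negP => l1.
have l0 : lf alpha v != 0 by rewrite -normr_gt0 (lt_le_trans ltr01).
have := sD (- (lf alpha v)^-1 *: v); rewrite normrZ normrN normfV.
have le : `|lf alpha v|^-1 * `|v| <= s.
  apply: le_trans vs; rewrite ler_piMl // invf_le1 //.
  by rewrite (lt_le_trans ltr01).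
move=> /(_ le) /def /Hdef; rewrite lfZ mulNr mulVf // subrr.
by rewrite eqxx.
Qed.

(* The line through phi(x) along v * eta is traversed projectively, hence
   phi maps a segment centred at x to one that extends at least |v eta|/2 on
   both sides of phi(x); so |v eta| is small when phi(x) is close to p. *)
Lemma aut_localized (x : 'rV[R]_d) (s : R) : D x ->
  proj_map (phi j) x @[j --> \oo] --> p ->
  (forall v : 'rV[R]_d, `|v| <= s -> D (x + v)) ->
  forall e : R, 0 < e -> \forall j \near \oo, forall v : 'rV[R]_d, `|v| <= s / 2 ->
    `|proj_map (phi j) (x + v) - proj_map (phi j) x| <= e.
Proof.
move=> Dx xp sD e e0.
have e4 : 0 < e / 4 by rewrite divr_gt0.
have [r r0 Hr] := short e4.
have H : \forall j \near \oo, `|proj_map (phi j) x - p| < r.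
  exact: cvgr_distC_lt xp _ r0.
apply: filterS H => j jr v vs.
have [def into _ _] := aut j.
have [alpha [eta Heta]] := proj_normal_form (def _ Dx).
have s0 : 0 <= s.
  by have := le_trans (normr_ge0 _) vs; rewrite pmulr_lge0 // invr_gt0.
have al := aut_alpha_lt1 (aut j) (fun v => (Heta v).1) sD.
have vs1 : `|v| <= s by apply: le_trans vs _; lra.
have l1 := al v vs1.
have l2 : `|lf alpha v| < 1 / 2.
  have := al (2 *: v); rewrite normrZ lfZ normrM ger0_norm // => H.
  by have {}H := H ltac:(lra); lra.
have b0 : 1 + lf alpha v != 0.
  by apply/eqP => b0; move: l1; rewrite (_ : lf alpha v = -1) ?normrN1 ?ltxx //; lra.
rewrite (Heta v).2 // addrAC subrr add0r normrZ normfV.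
have w4 : `|2^-1 *: (v *m eta)| <= e / 4.
  apply: Hr jr (into _ Dx) _ => t t1.
  pose th := t / 2.
  have th1 : `|th| <= 1 / 2.
    by rewrite normrM normfV (@ger0_norm _ 2) //; lra.
  have tl : `|th * lf alpha v| < 1 / 2.
    rewrite normrM; apply: (@le_lt_trans _ _ (1 / 2 * `|lf alpha v|)).
      by rewrite ler_wpM2r.
    lra.
  have dth : 0 < 1 - th * lf alpha v.
    by have := ler_norm (th * lf alpha v); lra.
  (* [u] solves [u / (1 + u * lf alpha v) = th], so [x + u *: v] is sent to the point with parameter
     [th] on the image line. As [|th| <= 1 / 2], it follows that [|u| <= 1]. *)
  pose u := th / (1 - th * lf alpha v).
  have us : `|u *: v| <= s.
    rewrite normrZ; apply: le_trans vs1; rewrite ler_piMl //.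
    rewrite /u normrM normfV ler_pdivrMr ?normr_gt0 ?gt_eqF // mul1r.
    rewrite (gtr0_norm dth); have := ler_norm (th * lf alpha v); lra.
  have Du := sD _ us.
  have bu := (Heta (u *: v)).1.1 (def _ Du).
  have := into _ Du; rewrite (Heta (u *: v)).2 //.
  rewrite -scalemxAl !scalerA; congr (D (_ + _ *: _)).
  have E : 1 + lf alpha (u *: v) = (1 - th * lf alpha v)^-1.
    by rewrite lfZ /u; field; rewrite gt_eqF.
  by rewrite E invrK /u mulrC divfK ?gt_eqF.
have {}w4 : `|v *m eta| <= e / 2.
  by move: w4; rewrite normrZ ger0_norm ?invr_ge0 //; lra.
rewrite ler_pdivrMl ?normr_gt0 //; apply: le_trans w4 _.
rewrite mulrC ler_wpM2r ?(ltW e0) //.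
have := ler_normD (1 + lf alpha v) (- lf alpha v).
by rewrite addrK normr1 normrN; lra.
Qed.

(** The set [E] of points whose orbit tends to [p] contains [q] and is relatively open and closed in
    [D], because convergence spreads from the centre of a ball in [D] to the ball of half the
    radius. *)
Lemma aut_cvg (q : 'rV[R]_d) : connected D -> D q ->
  proj_map (phi j) q @[j --> \oo] --> p ->
  forall x, D x -> proj_map (phi j) x @[j --> \oo] --> p.
Proof.
move=> cD Dq qp.
pose E : set 'rV[R]_d := [set x | D x /\ (proj_map (phi j) x @[j --> \oo] --> p)].
have step (x v : 'rV[R]_d) (s : R) : E x ->
    (forall v : 'rV[R]_d, `|v| <= s -> D (x + v)) -> `|v| <= s / 2 -> E (x + v).
  move=> [Dx xp] sD vs.
  have s0 : 0 <= s.
    by have := le_trans (normr_ge0 _) vs; rewrite pmulr_lge0 // invr_gt0.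
  split; first by apply: sD; apply: le_trans vs _; lra.
  apply/cvgrPdistC_le => e e0; have e2 : 0 < e / 2 by rewrite divr_gt0.
  have H := aut_localized Dx xp sD e2.
  near=> j.
  have -> : proj_map (phi j) (x + v) - p =
    (proj_map (phi j) (x + v) - proj_map (phi j) x) + (proj_map (phi j) x - p).
    by rewrite addrA subrK.
  rewrite (splitr e) (le_trans (ler_normD _ _)) // lerD //.
    by near: j; apply: filterS H => j; apply.
  by near: j; exact: cvgr_distC_le xp _ e2.
have ballD x : D x -> exists2 s : R, 0 < s &
    forall v : 'rV[R]_d, `|v| <= s -> D (x + v).
  move=> Dx; have [r r0 rD] := open_norm_ball oD Dx.
  exists (r / 2); first by rewrite divr_gt0.
  by move=> v vr; apply: rD; rewrite addrAC subrr add0r; lra.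
suff EE : E = D by move=> x; rewrite -EE => -[].
apply: cD.
- by exists q.
- exists E; last by apply/seteqP; split => [x Ex|x []//]; split => //; case: Ex.
  rewrite openE => x Ex; have [s s0 sD] := ballD x Ex.1.
  change (nbhs x E); apply: (nbhs_normP x E).2.
  exists (s / 2); first by rewrite /= divr_gt0.
  move=> y /= xy; rewrite (_ : y = x + (y - x)); last by rewrite addrC subrK.
  by apply: (step _ _ s) => //; rewrite distrC ltW.
- exists (closure E); first exact: closed_closure.
  apply/seteqP; split => [x Ex|x [Dx clx]].
    by split; [case: Ex|exact: subset_closure].
  have [s s0 sD] := ballD x Dx.
  (* The ball of radius [s / 2] about [y] lies in the one of radius [s] about [x], and [x] is within
     half of that smaller radius from [y]. *)
  have [|y [Ey /= xy]] := clx [set y | `|x - y| < s / 4].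
    by apply: (nbhs_normP x _).2; exists (s / 4) => //=; rewrite divr_gt0.
  rewrite (_ : x = y + (x - y)); last by rewrite addrC subrK.
  apply: (step _ _ (s / 2)) => //; last by lra.
  move=> v vs; rewrite (_ : y + v = x + (y - x + v)).
    by apply: sD; rewrite (le_trans (ler_normD _ _)) // distrC; lra.
  by rewrite addrA [x + _]addrC subrK.
Unshelve. all: by end_near. Qed.

End localization.

(** * Domains bounded by a quadric *)

Definition sqn (R : realType) (m : nat) (y : 'rV[R]_m) : R := \sum_i y 0 i ^+ 2.

Lemma sqnZ (R : realType) (m : nat) (a : R) (y : 'rV[R]_m) :
  sqn (a *: y) = a ^+ 2 * sqn y.
Proof. by rewrite mulr_sumr; apply: eq_bigr => i _; rewrite mxE exprMn. Qed.

Lemma sqn_ge0 (R : realType) (m : nat) (y : 'rV[R]_m) : 0 <= sqn y.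
Proof. by apply: sumr_ge0 => i _; exact: sqr_ge0. Qed.

Lemma sqn_eq0 (R : realType) (m : nat) (y : 'rV[R]_m) : sqn y = 0 -> y = 0.
Proof.
move=> /eqP; rewrite psumr_eq0 => [/allP y0|i _]; last exact: sqr_ge0.
apply/rowP => i; rewrite mxE; apply/eqP; rewrite -sqrf_eq0.
by apply: y0; rewrite mem_index_enum.
Qed.

(** Induction by completing the square in the first coordinate. [Q] may be asymmetric, so [beta]
    adds both off-diagonal blocks; [Q2] represents the remaining form. *)
Lemma posdef_sum_squares (R : realType) (m : nat) (Q : 'M[R]_m) :
  (forall v : 'rV[R]_m, v != 0 -> 0 < qf Q v) ->
  exists M : 'M[R]_m, forall v, qf Q v = sqn (v *m M).
Proof.
elim: m Q => [|m IH] Q posQ.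
  by exists 0 => v; rewrite qfE /sqn !big_ord0.
pose Q1 : 'M[R]_(1 + m) := Q.
pose a := ulsubmx Q1 0 0.
pose beta : 'cV[R]_m := (ursubmx Q1)^T + dlsubmx Q1.
pose Q' := drsubmx Q1.
have qfb (x : R) (y : 'rV[R]_m) : qf Q1 (row_mx x%:M y) =
    a * x ^+ 2 + x * lf beta y + qf Q' y.
  rewrite /qf -{1}(submxK Q1) tr_row_mx mul_row_block mul_row_col !mulmxDl.
  have addE (A B : 'M[R]_1) : (A + B) 0 0 = A 0 0 + B 0 0 by rewrite mxE.
  have trE (A : 'M[R]_1) : A 0 0 = A^T 0 0 by rewrite mxE.
  rewrite !addE.
  have -> : (x%:M *m ulsubmx Q1 *m (x%:M : 'M[R]_1)^T) 0 0 = a * x ^+ 2.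
    by rewrite tr_scalar_mx mul_scalar_mx mul_mx_scalar scalerA [LHS]mxE -/a; ring.
  have -> : (y *m dlsubmx Q1 *m (x%:M : 'M[R]_1)^T) 0 0 = x * (y *m dlsubmx Q1) 0 0.
    by rewrite tr_scalar_mx mul_mx_scalar [LHS]mxE.
  have -> : (x%:M *m ursubmx Q1 *m y^T) 0 0 = x * (y *m (ursubmx Q1)^T) 0 0.
    rewrite mul_scalar_mx -scalemxAl mxE; congr (_ * _).
    by rewrite [RHS]trE trmx_mul trmxK.
  rewrite /lf /beta mulmxDr addE -/Q'; ring.
have row0 (x : R) (y : 'rV[R]_m) : (row_mx x%:M y == 0 :> 'rV[R]_(1 + m)) =
    (x == 0) && (y == 0).
  rewrite row_mx_eq0; congr (_ && _).
  by apply/eqP/eqP => [/matrixP/(_ 0 0)|->]; rewrite ?raddf0 // !mxE.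
have a0 : 0 < a.
  have := posQ (row_mx 1%:M 0 : 'rV[R]_(1 + m)).
  rewrite row0 oner_eq0 => /(_ isT); rewrite -/Q1 qfb lf0 /qf !mul0mx mxE.
  by rewrite expr1n; lra.
pose Q2 := Q' - (4 * a)^-1 *: (beta *m beta^T).
have q2 y : qf Q2 y = qf Q' y - (4 * a)^-1 * lf beta y ^+ 2.
  rewrite /qf /Q2 mulmxBr mulmxBl mxE [X in _ + X = _]mxE; congr (_ - _).
  rewrite -scalemxAr -scalemxAl mxE; congr (_ * _).
  rewrite mulmxA -(mulmxA (y *m beta)) -trmx_mul [LHS]mxE big_ord1 [X in _ * X]mxE.
  by rewrite expr2.
have [y y0|M HM] := IH Q2.
  (* This first coordinate minimizes the form for fixed [y], and the minimum is [qf Q2 y]. *)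
  have := posQ (row_mx (- lf beta y / (2 * a))%:M y : 'rV[R]_(1 + m)).
  rewrite row0 (negbTE y0) andbF => /(_ isT); rewrite -/Q1 qfb q2.
  suff -> : a * (- lf beta y / (2 * a)) ^+ 2 + - lf beta y / (2 * a) * lf beta y +
    qf Q' y = qf Q' y - (4 * a)^-1 * lf beta y ^+ 2 by [].
  by field; rewrite gt_eqF.
pose s := Num.sqrt a.
have s2 : s ^+ 2 = a by rewrite sqr_sqrtr // ltW.
have s0 : s != 0 by rewrite gt_eqF // sqrtr_gt0.
pose M1 : 'M[R]_(1 + m) := block_mx s%:M 0 ((2 * s)^-1 *: beta) M.
suff H (v : 'rV[R]_(1 + m)) : qf Q1 v = sqn (v *m M1) by exists M1.
rewrite -(hsubmxK v); move: (rsubmx v) => y.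
rewrite [lsubmx v]mx11_scalar; move: (lsubmx v 0 0) => x.
rewrite qfb /M1 mul_row_block mulmx0 add0r /sqn big_split_ord big_ord1 /=.
under [X in _ = _ + X]eq_bigr do rewrite row_mxEr.
rewrite row_mxEl -[X in _ = _ + X]/(sqn (y *m M)) -HM q2.
have -> : (x%:M *m s%:M + y *m ((2 * s)^-1 *: beta)) 0 0 =
    x * s + (2 * s)^-1 * lf beta y.
  by rewrite -scalar_mxM -scalemxAr [LHS]mxE [X in _ + X]mxE mxE eqxx mulr1n.
by rewrite -s2; field.
Qed.

(** * Projective map of an ellipsoid onto the ball *)

Section ball.
Variables (R : realType) (d : nat) (D : set 'rV[R]_d) (q : 'rV[R]_d).
Variables (beta : 'cV[R]_d) (M : 'M[R]_d).
Hypothesis oD : open D.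
Hypothesis D_sub : forall v, D (q + v) -> sqn (v *m M) <= (1 + lf beta v) ^+ 2.
Hypothesis sub_D : forall s v, sqn (v *m M) < (s + lf beta v) ^+ 2 ->
  s != 0 /\ D (q + s^-1 *: v).
Hypothesis M_inj : forall v : 'rV[R]_d, v *m M = 0 -> v = 0.

(* If equality held at an interior point, the quadratic function along the ray
   from q would have a double zero there, which forces v M = 0. *)
Lemma D_sub_strict v : D (q + v) -> sqn (v *m M) < (1 + lf beta v) ^+ 2.
Proof.
move=> Dv; rewrite lt_neqAle D_sub // andbT; apply/eqP => E.
set b := lf beta v in E *.
have b1 : 1 + b != 0.
  apply/eqP => b1; have v0 : v = 0.
    by apply/M_inj/sqn_eq0; rewrite E b1 expr0n.
  by move: b1; rewrite /b v0 lf0 addr0 => /eqP; rewrite oner_eq0.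
have [r r0 rD] := open_norm_ball oD Dv.
(* The first bound keeps both points [q + (1 + u) *: v] with [u = t] and [u = - t] in [D]; the
   second makes [2 * (1 + b)] dominate in [key], so that its two instances contradict each other. *)
pose t := Num.min (r / (`|v| + 1)) (`|1 + b| / (`|1 + 2 * b| + 1)).
have k1 : 0 < `|v| + 1 by rewrite ltr_wpDl.
have k2 : 0 < `|1 + 2 * b| + 1 by rewrite ltr_wpDl.
have t0 : 0 < t by rewrite lt_min !divr_gt0 // normr_gt0.
have tv : t * `|v| < r.
  have : t <= r / (`|v| + 1) by rewrite ge_min lexx.
  rewrite ler_pdivlMr // => H; apply: lt_le_trans H.
  by rewrite mulrDr mulr1 ltrDl.
have tb : t * `|1 + 2 * b| < `|1 + b|.
  have : t <= `|1 + b| / (`|1 + 2 * b| + 1) by rewrite ge_min lexx orbT.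
  rewrite ler_pdivlMr // => H; apply: lt_le_trans H.
  by rewrite mulrDr mulr1 ltrDl.
have key u : `|u| = t -> u * (2 * (1 + b) + u * (1 + 2 * b)) <= 0.
  move=> ut; have : D (q + (1 + u) *: v).
    apply: rD; rewrite scalerDl scale1r addrA [_ - _]addrC addKr normrZ ut.
    exact: tv.
  move/D_sub; rewrite -scalemxAl sqnZ E lfZ -/b => H.
  suff -> : u * (2 * (1 + b) + u * (1 + 2 * b)) =
    (1 + u) ^+ 2 * (1 + b) ^+ 2 - (1 + (1 + u) * b) ^+ 2 by rewrite subr_le0.
  ring.
have kp := key t (gtr0_norm t0).
have kn : (- t) * (2 * (1 + b) + (- t) * (1 + 2 * b)) <= 0.
  by apply: key; rewrite normrN gtr0_norm.
rewrite pmulr_rle0 // in kp; rewrite mulNr oppr_le0 pmulr_rge0 // in kn.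
have := ler_norm (t * (1 + 2 * b)); have := ler_norm (- (t * (1 + 2 * b))).
rewrite normrN normrM (gtr0_norm t0) => n1 n2.
have [bp|bn] := leP 0 (1 + b).
  by rewrite (ger0_norm bp) in tb; lra.
by rewrite (ltr0_norm bn) in tb; lra.
Qed.

Lemma proj_equiv_ball_of_quadric : proj_equiv_ball D.
Proof.
(* In homogeneous coordinates [B] sends [x] to [1 + lf beta (x - q)] followed by [(x - q) *m M]. *)
pose B : 'M[R]_(1 + d) := block_mx (1%:M - q *m beta) (- (q *m M)) beta M.
have E x : lin_img B x = row_mx (1 + lf beta (x - q))%:M ((x - q) *m M).
  rewrite /lin_img /homog /B mul_row_block.
  have -> : const_mx 1 = 1%:M :> 'M[R]_1.
    by apply/matrixP => i j; rewrite !ord1 !mxE.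
  rewrite !mul1mx !mulmxBl [- _ + _]addrC; congr (row_mx _ _).
  rewrite [LHS]mx11_scalar /lf mulmxBl; congr (_%:M).
  by move: (q *m beta) (x *m beta) => y z; rewrite !mxE eqxx mulr1n; ring.
have Eb x : lsubmx (lin_img B x) 0 0 = 1 + lf beta (x - q).
  by rewrite E row_mxKl mxE eqxx.
have EB x : proj_map B x = (1 + lf beta (x - q))^-1 *: ((x - q) *m M).
  by rewrite /proj_map Eb E row_mxKr.
have strict x : D x -> sqn ((x - q) *m M) < (1 + lf beta (x - q)) ^+ 2.
  by move=> Dx; apply: D_sub_strict; rewrite addrC subrK.
have b0 x : D x -> 1 + lf beta (x - q) != 0.
  move=> /strict H; rewrite -sqrf_eq0 gt_eqF //.
  exact: le_lt_trans (sqn_ge0 _) H.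
exists B; split.
- by move=> x Dx; rewrite /proj_defined Eb b0.
- move=> x Dx; rewrite /unit_ball /= -/(sqn (proj_map B x)) EB sqnZ exprVn.
  rewrite ltr_pdivrMl ?mulr1 ?strict //.
  by rewrite exprn_even_gt0 //= b0.
- move=> x y /set_mem Dx /set_mem Dy; rewrite !EB.
  have := b0 x Dx; have := b0 y Dy.
  move=> by0 bx0 Hxy; apply: (addIr (- q)); move: by0 bx0 Hxy.
  move: (x - q) (y - q) => u v bv bu H.
  set k := (1 + lf beta u)^-1 in H; set l := (1 + lf beta v)^-1 in H.
  have k0 : k != 0 by rewrite invr_eq0.
  have uv : k *: u = l *: v.
    apply/eqP; rewrite -subr_eq0; apply/eqP/M_inj.
    by rewrite mulmxBl -!scalemxAl H subrr.
  have kl : k = l.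
    have := congr1 (lf beta) uv; rewrite !lfZ.
    have -> : lf beta u = k^-1 - 1 by rewrite invrK; ring.
    have -> : lf beta v = l^-1 - 1 by rewrite invrK; ring.
    rewrite !mulrBr !mulfV ?mulr1 // ?invr_eq0 //; lra.
  by apply: (scalerI k0); rewrite {2}kl.
- move=> y yb.
  have uM : M \in unitmx by rewrite -row_free_unit; exact: inj_row_free M_inj.
  pose u := y *m invmx M; have uy : u *m M = y by rewrite mulmxKV.
  (* This choice gives the homogeneous vector [(s, u)] denominator 1 and numerator [y]; [sub_D]
     guarantees that it is not at infinity. *)
  pose s := 1 - lf beta u.
  have [s0 Ds] : s != 0 /\ D (q + s^-1 *: u).
    by apply: sub_D; rewrite uy subrK expr1n.
  exists (q + s^-1 *: u) => //.
  rewrite EB addrAC subrr add0r -scalemxAl uy lfZ scalerA.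
  have -> : 1 + s^-1 * lf beta u = s^-1.
    by rewrite (_ : lf beta u = 1 - s); [field|rewrite /s; ring].
  by rewrite invrK mulfV // scale1r.
Qed.

End ball.

(** * Scaling along the orbit *)

Lemma norm_rV1 (R : realType) (x : 'rV[R]_1) : `|x| = `|x 0 0|.
Proof.
apply/le_anti/andP; split; last exact: coord_le_norm.
by apply: rV_norm_le => // i; rewrite ord1.
Qed.

Lemma mulmx_bound_scale (R : realType) (m n : nat) (F : 'M[R]_(m, n)) (s C : R) :
  0 < s -> (forall v : 'rV[R]_m, `|v| <= s -> `|v *m F| <= C) ->
  forall v : 'rV[R]_m, `|v *m F| <= C / s * `|v|.
Proof.
move=> s0 HC v; have [->|v0] := eqVneq v 0; first by rewrite mul0mx !normr0 mulr0.
have nv : 0 < `|v| by rewrite normr_gt0.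
have [t t0 tv] : exists2 t : R, 0 < t & t * `|v| = s.
  by exists (s / `|v|); [exact: divr_gt0|rewrite divfK ?gt_eqF].
have := HC (t *: v); rewrite -scalemxAl !normrZ (gtr0_norm t0) tv lexx => /(_ isT).
rewrite -tv mulrC -ler_pdivlMr // => /le_trans; apply.
by rewrite le_eqVlt; apply/orP; left; apply/eqP; field; rewrite !gt_eqF.
Qed.

Section boundary_point.
Variables (R : realType) (d : nat) (D U : set 'rV[R]_d) (rho : 'rV[R]_d -> R).
Variable p : 'rV[R]_d.
Hypotheses (oU : open U) (Up : U p) (C2 : C2_on U rho).
Hypothesis DU : D `&` U = [set x | U x /\ rho x < 0].
Hypothesis convex_p : forall v : 'rV[R]_d, v != 0 -> lf (grad rho p) v = 0 ->
  0 < qf (hess rho p) v.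
Hypothesis nDp : ~ D p.

(** Since [p] lies outside [D], [rho p >= 0]; continuity does the rest. *)
Lemma rho_near_p (e : R) : 0 < e -> exists2 r : R, 0 < r &
  forall z, `|z - p| < r -> - rho z < e.
Proof.
move=> e0; have e2 : 0 < e / 2 by rewrite divr_gt0.
have [c0 _ _ _ _] := C2.
have /nbhs_normP[r /= r0 H] := within_open_near oU c0 Up e2.
have [r' r'0 Hr'] := D_near_p oU Up DU.
have rp : 0 <= rho p.
  by rewrite leNgt; apply/negP => /(Hr' p _).2; apply/not_implyP;
    rewrite subrr normr0; split.
exists r => // z zr; have := H z; rewrite /= distrC => /(_ zr).
by rewrite ler_norml => /andP[]; lra.
Qed.

Lemma short_near_p (e : R) : 0 < e -> exists2 r : R, 0 < r &
  forall z w : 'rV[R]_d, `|z - p| < r -> D z ->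
    (forall t : R, `|t| <= 1 -> D (z + t *: w)) -> `|w| <= e.
Proof.
move=> e0; have [c [r [c0 r0 est]]] := strictly_convex_estimate oU Up C2 DU convex_p.
pose e' := Num.min e (r / 2).
have e'0 : 0 < e' by rewrite lt_min e0 divr_gt0.
have k0 : 0 < c * e' ^+ 2 / 2 by rewrite divr_gt0 // mulr_gt0 // exprn_gt0.
have [r1 r10 Hr1] := rho_near_p k0.
exists (Num.min r1 (r / 2)); first by rewrite lt_min r10 divr_gt0.
move=> z w; rewrite lt_min => /andP[z1 z2] Dz seg.
apply: (@le_trans _ _ e'); last by rewrite ge_min lexx.
apply: (short_segments c0 r0 est z2 Dz seg).
  by rewrite e'0 ge_min lexx orbT.
by have := Hr1 z z1; lra.
Qed.

End boundary_point.

Section scaling.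
Variables (R : realType) (d : nat) (D U : set 'rV[R]_d) (rho : 'rV[R]_d -> R).
Variables (p q : 'rV[R]_d) (phi : nat -> 'M[R]_(1 + d)).
Variables (alpha : nat -> 'cV[R]_d) (eta : nat -> 'M[R]_d).
Hypotheses (oU : open U) (Up : U p) (C2 : C2_on U rho).
Hypothesis DU : D `&` U = [set x | U x /\ rho x < 0].
Hypothesis convex_p : forall v : 'rV[R]_d, v != 0 -> lf (grad rho p) v = 0 ->
  0 < qf (hess rho p) v.
Hypotheses (oD : open D) (nDp : ~ D p) (Dq : D q).
Hypothesis aut : forall j, proj_aut D (phi j).
Hypothesis cvg_p : forall x, D x -> proj_map (phi j) x @[j --> \oo] --> p.
Hypothesis normal : forall j (v : 'rV[R]_d),
  (proj_defined (phi j) (q + v) <-> 1 + lf (alpha j) v != 0) /\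
  (1 + lf (alpha j) v != 0 -> proj_map (phi j) (q + v) =
    proj_map (phi j) q + (1 + lf (alpha j) v)^-1 *: (v *m eta j)).

Let Q j := proj_map (phi j) q.
Let lam j := - rho (Q j).
(** Anisotropic scaling: the component of [eta j] along the gradient is divided by [lam j], while
    [nu j] divides all of [eta j] only by its square root. *)
Let mu j : 'cV[R]_d := (lam j)^-1 *: (eta j *m grad rho (Q j)).
Let nu j : 'M[R]_d := (Num.sqrt (lam j))^-1 *: eta j.
Let H := hess rho p.
(* A pair (s, v) stands for the homogeneous vector s (1, q) + (0, v), that is,
   for the point q + v / s.  [Sj j] is the second Taylor polynomial of rho at
   [Q j], homogenized, pulled back by [phi j] and divided by [lam j]. *)
Let Sj j (s : R) (v : 'rV[R]_d) :=
  - (s + lf (alpha j) v) ^+ 2 + (s + lf (alpha j) v) * lf (mu j) v +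
  qf H (v *m nu j) / 2.

Let DQ j : D (Q j).
Proof. by have [_ into _ _] := aut j; exact: into. Qed.

Lemma ball_in_D (x : 'rV[R]_d) : D x -> exists2 s : R, 0 < s &
    forall v : 'rV[R]_d, `|v| <= s -> D (x + v).
Proof.
move=> Dx; have [r r0 rD] := open_norm_ball oD Dx.
exists (r / 2); first by rewrite divr_gt0.
by move=> v vr; apply: rD; rewrite [_ - _]addrC addKr; lra.
Qed.

(** A kernel vector would give a small segment at [q] on which [phi j] is constant, against
    injectivity on [D]. *)
Lemma eta_inj j (w : 'rV[R]_d) : w *m eta j = 0 -> w = 0.
Proof.
move=> we; have [s s0 sD] := ball_in_D Dq.
have k0 : 0 < `|w| + 1 by rewrite ltr_wpDl.
pose t := s / (`|w| + 1); have t0 : 0 < t by rewrite divr_gt0.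
have Dt : D (q + t *: w).
  apply: sD; rewrite normrZ gtr0_norm // /t mulrAC ler_pdivrMr //.
  by rewrite ler_wpM2l ?lerDl // ltW.
have [def _ inj _] := aut j.
have := (normal j (t *: w)).2 ((normal j (t *: w)).1.1 (def _ Dt)).
rewrite -scalemxAl we !scaler0 addr0 => E.
have := inj _ _ (mem_set Dt) (mem_set Dq) E.
move/(congr1 (fun x => x - q)); rewrite subrr addrAC subrr add0r => /eqP.
by rewrite scaler_eq0 gt_eqF //= => /eqP.
Qed.

(** On a full line in [D] the denominator has no zero, hence is constant. So [phi j] maps the line
    affinely to one through [Q j], too long for [short_near_p] once [Q j] is close to [p]. *)
Lemma no_line (v : 'rV[R]_d) : (forall t : R, D (q + t *: v)) -> v = 0.
Proof.
move=> line.
have [r r0 Hr] := short_near_p oU Up C2 DU convex_p nDp ltr01.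
have QP : \forall j \near \oo, `|Q j - p| < r.
  exact: cvgr_distC_lt (cvg_p Dq) _ r0.
have [j jr] := filter_ex QP.
have [def into _ _] := aut j.
have a0 t := (normal j (t *: v)).1.1 (def _ (line t)).
have av : lf (alpha j) v = 0.
  apply/eqP/negPn/negP => av; have := a0 (- (lf (alpha j) v)^-1).
  by rewrite lfZ mulNr mulVf // subrr eqxx.
have seg t : D (Q j + t *: (v *m eta j)).
  have := into _ (line t); rewrite (normal j _).2 //.
  by rewrite lfZ av mulr0 addr0 invr1 scale1r -scalemxAl.
apply: (@eta_inj j); apply/eqP; rewrite -normr_eq0.
apply/negPn/negP; rewrite normr_eq0 -normr_gt0 => n0.
have := Hr (Q j) ((2 / `|v *m eta j|) *: (v *m eta j)) jr (DQ j).
rewrite normrZ normrM normfV normr_id divfK ?gt_eqF // ger0_norm //.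
have H1 : forall t : R, `|t| <= 1 ->
    D (Q j + t *: ((2 / `|v *m eta j|) *: (v *m eta j))).
  by move=> t _; rewrite scalerA.
by move=> /(_ H1); lra.
Qed.

Lemma lam_near (e : R) : 0 < e -> \forall j \near \oo, 0 < lam j < e.
Proof.
move=> e0; have [r r0 Hr] := rho_near_p oU Up C2 DU nDp e0.
have [r1 r10 Hr1] := D_near_p oU Up DU.
have QP : \forall j \near \oo, `|Q j - p| < Num.min r r1.
  by apply: cvgr_distC_lt (cvg_p Dq) _ _; rewrite lt_min r0.
apply: filterS QP => j; rewrite lt_min => /andP[j1 j2].
by rewrite /lam Hr // andbT oppr_gt0; apply: (Hr1 _ j2).1.
Qed.

Lemma lf_mu j (v : 'rV[R]_d) :
  lf (mu j) v = (lam j)^-1 * lf (grad rho (Q j)) (v *m eta j).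
Proof. by rewrite lfZl /lf mulmxA. Qed.

Lemma mul_nu j (v : 'rV[R]_d) : v *m nu j = (Num.sqrt (lam j))^-1 *: (v *m eta j).
Proof. by rewrite -scalemxAr. Qed.

Lemma norm_nu j (v : 'rV[R]_d) : 0 < lam j ->
  `|v *m nu j| ^+ 2 = (lam j)^-1 * `|v *m eta j| ^+ 2.
Proof.
move=> l0; rewrite mul_nu normrZ exprMn ger0_norm ?invr_ge0 ?sqrtr_ge0 //.
by rewrite exprVn sqr_sqrtr // ltW.
Qed.

Lemma qf_nu j (v : 'rV[R]_d) : 0 < lam j ->
  qf H (v *m nu j) = (lam j)^-1 * qf H (v *m eta j).
Proof. by move=> l0; rewrite mul_nu qfZ exprVn sqr_sqrtr // ltW. Qed.

(** This is [taylor2] at [Q j] multiplied by [(lam j)^-1 * (s + lf (alpha j) v) ^+ 2]; the weight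
    clears the denominators and turns [|y| ^+ 2] into [|v *m nu j| ^+ 2], which stays bounded. *)
Lemma rescaled_taylor (e : R) : 0 < e -> exists2 r : R, 0 < r &
  forall j (s : R) (v y : 'rV[R]_d), 0 < lam j -> s + lf (alpha j) v != 0 ->
  y = (s + lf (alpha j) v)^-1 *: (v *m eta j) ->
  `|Q j - p| < r -> `|Q j + y - p| < r ->
  `|(lam j)^-1 * (s + lf (alpha j) v) ^+ 2 * rho (Q j + y) - Sj j s v|
    <= e * `|v *m nu j| ^+ 2.
Proof.
move=> e0; have [r r0 Hr] := taylor2 oU C2 Up e0.
exists r => // j s v y l0 a0 yE Qr Qyr.
have := Hr (Q j) y Qr Qyr.
rewrite /Sj lf_mu norm_nu // qf_nu //.
move: a0 yE; set a := s + _ => a0 ->.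
rewrite normrZ lfZ qfZ -/H; set w := v *m eta j; set X := rho (_ + _).
rewrite -[rho (Q j)]opprK -/(lam j) => T.
have k0 : 0 < (lam j)^-1 * a ^+ 2 by rewrite mulr_gt0 ?invr_gt0 // exprn_even_gt0.
have := ler_wpM2l (ltW k0) T.
rewrite -{1}(gtr0_norm k0) -normrM.
have l0' : lam j != 0 by rewrite gt_eqF.
suff -> : (lam j)^-1 * a ^+ 2 * (e * (`|a^-1| * `|w|) ^+ 2) =
    e * ((lam j)^-1 * `|w| ^+ 2).
  apply: le_trans; rewrite le_eqVlt; apply/orP; left; apply/eqP; congr `|_|.
  by field; rewrite a0.
rewrite exprMn real_normK ?num_real //; field; exact/andP.
Qed.

(* By [strictly_convex_estimate], 2 lam - grad rho(Q j) . (phi(q+v) - Q j) is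
   nonnegative; multiplied by the denominator 1 + alpha v it is affine in v and
   equals 2 lam at v = 0, so it is O(lam) on a ball, and so is |v eta|^2. *)
Lemma rescaled_bounds : exists s C : R, [/\ 0 < s, 0 < C &
  \forall j \near \oo, forall v : 'rV[R]_d, `|v| <= s ->
    [/\ `|lf (alpha j) v| <= C, `|lf (mu j) v| <= C & `|v *m nu j| <= C]].
Proof.
have [c [r [c0 r0 est]]] := strictly_convex_estimate oU Up C2 DU convex_p.
have [s s0 sD] := ball_in_D Dq.
(* [|lf (mu j) v| <= 4] gives [c * |v *m nu j| ^+ 2 <= 16], and [x ^+ 2 <= k] implies
   [x <= k + 4]. *)
exists (s / 2), (16 / c + 4); split; first by rewrite divr_gt0.
  by rewrite addr_gt0 // divr_gt0.
have r4 : 0 < r / 4 by rewrite divr_gt0.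
have loc := aut_localized aut (short_near_p oU Up C2 DU convex_p nDp) Dq
  (cvg_p Dq) sD r4.
have QP : \forall j \near \oo, `|Q j - p| < r / 2.
  by apply: cvgr_distC_lt (cvg_p Dq) _ _; rewrite divr_gt0.
have lamP := lam_near ltr01.
near=> j.
have jr : `|Q j - p| < r / 2 by near: j.
have /andP[l0 _] : 0 < lam j < 1 by near: j.
have locj : forall v : 'rV[R]_d, `|v| <= s / 2 ->
  `|proj_map (phi j) (q + v) - Q j| <= r / 4 by near: j.
have al := aut_alpha_lt1 (aut j) (fun v => (normal j v).1) sD.
have [def into _ _] := aut j.
have half (v : 'rV[R]_d) : `|v| <= s / 2 -> lf (mu j) v <= 4 /\
    c * `|v *m nu j| ^+ 2 <= 2 * (4 - lf (mu j) v).
  move=> vs; have vs1 : `|v| <= s by lra.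
  have := al v vs1; rewrite ltr_norml => /andP[a1 a2].
  have Dv := sD v vs1.
  have a0 := (normal j v).1.1 (def _ Dv).
  pose y := (1 + lf (alpha j) v)^-1 *: (v *m eta j).
  have yE : proj_map (phi j) (q + v) = Q j + y by exact: (normal j v).2.
  have yr : `|y| <= r / 4 by have := locj v vs; rewrite yE [_ - _]addrC addKr.
  have := est (Q j) y _ _ (DQ j) _; rewrite -yE => /(_ _ _ (into _ Dv)).
  have zr : `|Q j - p| < r by lra.
  have zyr : `|proj_map (phi j) (q + v) - p| < r.
    rewrite yE addrAC (le_lt_trans (ler_normD _ _)) //; lra.
  move=> /(_ zr zyr); rewrite /y normrZ lfZ.
  have -> : lf (grad rho (Q j)) (v *m eta j) = lam j * lf (mu j) v.
    by rewrite lf_mu mulrA mulfV ?mul1r // gt_eqF.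
  rewrite exprMn real_normK ?num_real //.
  have -> : `|v *m eta j| ^+ 2 = lam j * `|v *m nu j| ^+ 2.
    by rewrite norm_nu // mulrA mulfV ?mul1r // gt_eqF.
  set a := 1 + _ in a0 *; have ap : 0 < a by rewrite /a; lra.
  have al2 : a < 2 by rewrite /a; lra.
  have -> : - 2 * rho (Q j) = 2 * lam j by rewrite /lam; ring.
  move: (`|v *m nu j| ^+ 2) (lf (mu j) v) (sqr_ge0 `|v *m nu j|) => N m N0 E.
  have {}E : c * N <= a * (2 * a - m).
    have k0 : 0 < a ^+ 2 / lam j by rewrite divr_gt0 // exprn_gt0.
    have := ler_wpM2l (ltW k0) E.
    have l0' : lam j != 0 by rewrite gt_eqF.
    have -> : a ^+ 2 / lam j * (c * (a^-1 ^+ 2 * (lam j * N))) = c * N.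
      by field; apply/andP.
    have -> // : a ^+ 2 / lam j * (2 * lam j - a^-1 * (lam j * m)) =
      a * (2 * a - m) by field; apply/andP.
  have m1 : 0 <= 2 * a - m.
    by rewrite -(pmulr_rge0 _ ap) (le_trans _ E) // mulr_ge0 // ltW.
  split; first by lra.
  apply: le_trans E _; nra.
move=> v vs; have [m1 n1] := half v vs.
(* [half] bounds [lf (mu j)] only from above; the opposite vector supplies the lower bound. *)
have [m2 _] := half (- v) ltac:(by rewrite normrN).
rewrite lfN in m2.
have C4 : 4 <= 16 / c + 4 by rewrite lerDr divr_ge0 // ltW.
split.
- have /ltW := al v ltac:(lra); lra.
- by rewrite ler_norml; apply/andP; split; lra.
- have : `|v *m nu j| ^+ 2 <= 16 / c by rewrite ler_pdivlMr // mulrC; lra.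
  have := normr_ge0 (v *m nu j); move: `|_| (16 / c) => x k; nra.
Unshelve. all: by end_near. Qed.


Let S (al mu_ : 'cV[R]_d) (nu_ : 'M[R]_d) (s : R) (v : 'rV[R]_d) :=
  - (s + lf al v) ^+ 2 + (s + lf al v) * lf mu_ v + qf H (v *m nu_) / 2.

(** * The limit quadric along an ultrafilter *)

Section limit.
Variables (G : set_system nat) (GU : UltraFilter G) (sG : \oo `<=` G).

Lemma scaling_limit : exists (al mu_ : 'cV[R]_d) (nu_ : 'M[R]_d),
  forall v : 'rV[R]_d, [/\ lf (alpha j) v @[j --> G] --> lf al v,
    lf (mu j) v @[j --> G] --> lf mu_ v & v *m nu j @[j --> G] --> v *m nu_].
Proof.
have [s [C [s0 C0 HC]]] := rescaled_bounds.
have bd (n : nat) (F : nat -> 'M[R]_(d, n)) :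
    (\forall j \near \oo, forall v : 'rV[R]_d, `|v| <= s -> `|v *m F j| <= C) ->
    forall v : 'rV[R]_d, exists B : R, \forall j \near G, `|v *m F j| <= B.
  move=> FC v; exists (C / s * `|v|); apply: sG; apply: filterS FC => j FC.
  exact: mulmx_bound_scale.
have col (F : nat -> 'cV[R]_d) :
    (\forall j \near \oo, forall v : 'rV[R]_d, `|v| <= s -> `|lf (F j) v| <= C) ->
    exists L : 'cV[R]_d, forall v, lf (F j) v @[j --> G] --> lf L v.
  move=> FC; have [|L HL] := @ultra_mulmx_cvg R nat G GU d 1 F.
    apply: bd; apply: filterS FC => j FC v /FC.
    by rewrite norm_rV1.
  exists L => v.
  by apply: (continuous_cvg _ (@coord_continuous _ _ _ 0 0 _) (HL v)).
have [|al Hal] := col alpha.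
  by apply: filterS HC => j HC v /HC[].
have [|mu_ Hmu] := col mu.
  by apply: filterS HC => j HC v /HC[].
have [|nu_ Hnu] := @ultra_mulmx_cvg R nat G GU d d nu.
  by apply: bd; apply: filterS HC => j HC v /HC[].
by exists al, mu_, nu_.
Qed.

Variables (al mu_ : 'cV[R]_d) (nu_ : 'M[R]_d).
Hypothesis lim : forall v : 'rV[R]_d, [/\ lf (alpha j) v @[j --> G] --> lf al v,
    lf (mu j) v @[j --> G] --> lf mu_ v & v *m nu j @[j --> G] --> v *m nu_].

Lemma Sj_cvg (s : R) (v : 'rV[R]_d) : Sj j s v @[j --> G] --> S al mu_ nu_ s v.
Proof.
have [la lm ln] := lim v.
have lsa : s + lf (alpha j) v @[j --> G] --> s + lf al v.
  by apply: cvgD => //; exact: cvg_cst.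
apply: cvgD; last first.
  apply: cvgM; last exact: cvg_cst.
  by apply: (continuous_cvg _ _ ln); exact: continuous_qf.
apply: cvgD; last exact: cvgM.
by apply: cvgN; rewrite expr2; under eq_fun do rewrite expr2; exact: cvgM.
Qed.

Lemma nu_bound (v : 'rV[R]_d) : exists2 B : R, 0 < B &
  \forall j \near G, `|v *m nu j| <= B.
Proof.
have [_ _ ln] := lim v; exists (`|v *m nu_| + 1); first by rewrite ltr_wpDl.
by apply: cvgr_le (cvg_norm ln) _ _; rewrite ltrDl.
Qed.

Lemma Q_nearG (r : R) : 0 < r -> \forall j \near G, `|Q j - p| < r.
Proof. by move=> r0; apply: sG; exact: cvgr_distC_lt (cvg_p Dq) _ r0. Qed.

Lemma lam_nearG (e : R) : 0 < e -> \forall j \near G, 0 < lam j < e.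
Proof. by move=> e0; apply: sG; exact: lam_near. Qed.

(** The gradient at [Q j] applied to [v *m nu j] equals [Num.sqrt (lam j) * lf (mu j) v], which
    tends to 0. Thus limit directions are tangent at [p], where the Hessian is positive definite. *)
Lemma nu_tangent (v : 'rV[R]_d) : lf (grad rho p) (v *m nu_) = 0.
Proof.
have [_ lm ln] := lim v.
have lg : lf (grad rho p) (v *m nu j) @[j --> G] --> lf (grad rho p) (v *m nu_).
  by apply: (continuous_cvg _ _ ln); exact: continuous_lf.
have [B B0 HB] := nu_bound v.
have HM : \forall j \near G, `|lf (mu j) v| <= `|lf mu_ v| + 1.
  by apply: cvgr_le (cvg_norm lm) _ _; rewrite ltrDl.
set K := `|lf mu_ v| + 1 in HM.
have K0 : 0 < K by rewrite ltr_wpDl.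
apply/eqP; rewrite -normr_le0; apply/ler_addgt0Pl => e e0; rewrite addr0.
have e1 : 0 < e / (2 * B) by rewrite divr_gt0 // mulr_gt0.
have e2 : 0 < e / (2 * K) by rewrite divr_gt0 // mulr_gt0.
have [r r0 Hr] := grad_near oU C2 Up e1.
have Qr := Q_nearG r0.
have lr : \forall j \near G, 0 < lam j < (e / (2 * K)) ^+ 2.
  by apply: lam_nearG; rewrite exprn_gt0.
apply: (cvgr_to_le (cvg_norm lg)); near=> j.
have jr : `|Q j - p| < r by near: j.
have /andP[l0 l1] : 0 < lam j < (e / (2 * K)) ^+ 2 by near: j.
have jB : `|v *m nu j| <= B by near: j.
have jK : `|lf (mu j) v| <= K by near: j.
set w := v *m nu j in jB *.
have H1 := Hr (Q j) w jr.
have H2 : `|lf (grad rho (Q j)) w| <= e / 2.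
  have -> : lf (grad rho (Q j)) w = Num.sqrt (lam j) * lf (mu j) v.
    rewrite /w mul_nu lfZ lf_mu mulrA; congr (_ * _).
    have s0 : Num.sqrt (lam j) != 0 by rewrite gt_eqF // sqrtr_gt0.
    move: (sqr_sqrtr (ltW l0)) s0; move: (Num.sqrt (lam j)) => t <- t0.
    by field.
  rewrite normrM (ger0_norm (sqrtr_ge0 _)).
  apply: (@le_trans _ _ (e / (2 * K) * K)).
    apply: ler_pM => //; rewrite ?sqrtr_ge0 //.
    rewrite -(ger0_norm (ltW e2)) -sqrtr_sqr ler_sqrt; first exact: ltW.
    exact: sqr_ge0.
  by rewrite le_eqVlt; apply/orP; left; apply/eqP; field; rewrite gt_eqF.
have H3 : `|lf (grad rho (Q j)) w - lf (grad rho p) w| <= e / 2.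
  apply: le_trans H1 _; apply: (@le_trans _ _ (e / (2 * B) * B)).
    by apply: ler_pM => //; exact: ltW.
  by rewrite le_eqVlt; apply/orP; left; apply/eqP; field; rewrite gt_eqF.
have -> : lf (grad rho p) w = lf (grad rho (Q j)) w -
  (lf (grad rho (Q j)) w - lf (grad rho p) w) by ring.
by apply: le_trans (ler_normB _ _) _; lra.
Unshelve. all: by end_near. Qed.

(** The images of [q + v] tend to [p] inside [D], where [rho < 0]; [rescaled_taylor] bounds
    [Sj j 1 v] by any [e > 0] along [G]. *)
Lemma D_sub_quadric (v : 'rV[R]_d) : D (q + v) -> S al mu_ nu_ 1 v <= 0.
Proof.
move=> Dv; have [B B0 HB] := nu_bound v.
apply/ler_addgt0Pl => e e0; rewrite addr0.
have e1 : 0 < e / B ^+ 2 by rewrite divr_gt0 // exprn_gt0.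
have [r r0 Hr] := rescaled_taylor e1.
have [r1 r10 Hr1] := D_near_p oU Up DU.
have Qr := Q_nearG r0; have lr := lam_nearG ltr01.
have Vr : \forall j \near G, `|proj_map (phi j) (q + v) - p| < Num.min r r1.
  by apply: sG; apply: cvgr_distC_lt (cvg_p Dv) _ _; rewrite lt_min r0.
apply: (cvgr_to_le (@Sj_cvg 1 v)); near=> j.
have jr : `|Q j - p| < r by near: j.
have /andP[l0 _] : 0 < lam j < 1 by near: j.
have jB : `|v *m nu j| <= B by near: j.
have : `|proj_map (phi j) (q + v) - p| < Num.min r r1 by near: j.
rewrite lt_min => /andP[v1 v2].
have [def into _ _] := aut j.
have a0 := (normal j v).1.1 (def _ Dv).
have yE := (normal j v).2 a0.
have := (Hr1 _ v2).1 (into _ Dv); rewrite yE in v1 *.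
move=> rneg; have := Hr j 1 v _ l0 a0 erefl jr v1.
rewrite ler_norml => /andP[+ _].
set X := _ * rho _ => HX.
have X0 : X <= 0.
  by rewrite /X mulr_ge0_le0 ?(ltW rneg) // mulr_ge0 ?sqr_ge0 // invr_ge0 ltW.
have HB2 : e / B ^+ 2 * `|v *m nu j| ^+ 2 <= e.
  rewrite mulrAC ler_pdivrMr ?exprn_gt0 // ler_wpM2l ?(ltW e0) //.
  by rewrite !expr2 ler_pM.
lra.
Unshelve. all: by end_near. Qed.

(** For a suitable [j] the Taylor estimate puts [Q j + y] in [D]. Surjectivity of [phi j] gives a
    preimage [q + u] in [D], and injectivity of [eta j] makes [(s, v)] a nonzero multiple of
    [(1, u)]; hence [s != 0]. *)
Lemma quadric_sub_D (s : R) (v : 'rV[R]_d) : S al mu_ nu_ s v < 0 ->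
  s != 0 /\ D (q + s^-1 *: v).
Proof.
move=> S0; have [la _ ln] := lim v.
have [N N0 HN] := finsler convex_p.
have q0 : 0 <= qf H (v *m nu_).
  have := HN (v *m nu_); rewrite nu_tangent expr0n mulr0 addr0.
  by apply: le_trans; rewrite divr_ge0 ?exprn_ge0 // ltW.
set a := s + lf al v.
have a0 : a != 0.
  apply/eqP => a0; move: S0; rewrite /S -/a a0 expr0n mul0r oppr0 !add0r.
  by apply/negP; rewrite -leNgt divr_ge0.
have [B B0 HB] := nu_bound v.
(* The Taylor error is then at most half of [- S], while [Sj j s v] is below half of [S]. *)
pose e := - S al mu_ nu_ s v / (2 * B ^+ 2).
have B2 : 0 < B ^+ 2 by rewrite exprn_gt0.
have e0 : 0 < e by rewrite divr_gt0 ?mulr_gt0 // oppr_gt0.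
have [r r0 Hr] := rescaled_taylor e0.
have [r1 r10 Hr1] := D_near_p oU Up DU.
pose r2 := Num.min r r1.
have r20 : 0 < r2 by rewrite lt_min r0.
have r22 : 0 < r2 / 2 by rewrite divr_gt0.
have Qr := Q_nearG r22.
have na : 0 < `|a| by rewrite normr_gt0.
(* With [Num.sqrt (lam j) <= k], [|v *m eta j|] is at most [r2 / 2] times [|a| / 2], and [|a| / 2]
   is below the denominator [|b|]. *)
pose k := r2 / 2 * (`|a| / 2) / B.
have k0 : 0 < k by rewrite divr_gt0 // mulr_gt0 // divr_gt0.
have lr : \forall j \near G, 0 < lam j < k ^+ 2 by apply: lam_nearG; rewrite exprn_gt0.
have aG : \forall j \near G, `|a| / 2 < `|s + lf (alpha j) v|.
  have lsa : s + lf (alpha j) v @[j --> G] --> a.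
    by apply: cvgD => //; exact: cvg_cst.
  by apply: cvgr_gt (cvg_norm lsa) _ _; lra.
have SG : \forall j \near G, Sj j s v < S al mu_ nu_ s v / 2.
  by apply: cvgr_lt (@Sj_cvg s v) _ _; lra.
near G => j.
have jr : `|Q j - p| < r2 / 2 by near: j.
have /andP[l0 lk] : 0 < lam j < k ^+ 2 by near: j.
have jB : `|v *m nu j| <= B by near: j.
have ja : `|a| / 2 < `|s + lf (alpha j) v| by near: j.
have jS : Sj j s v < S al mu_ nu_ s v / 2 by near: j.
set b := s + lf (alpha j) v in ja.
have nb : 0 < `|b| by apply: lt_trans ja; rewrite divr_gt0.
have b0 : b != 0 by rewrite -normr_gt0.
pose y := b^-1 *: (v *m eta j).
have yr : `|y| <= r2 / 2.
  rewrite normrZ normfV ler_pdivrMl //.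
  have vn : `|v *m eta j| = Num.sqrt (lam j) * `|v *m nu j|.
    rewrite mul_nu normrZ ger0_norm ?invr_ge0 ?sqrtr_ge0 //.
    by rewrite mulrA mulfV ?mul1r // gt_eqF // sqrtr_gt0.
  have sk : Num.sqrt (lam j) <= k.
    by rewrite -(ger0_norm (ltW k0)) -sqrtr_sqr ler_sqrt ?sqr_ge0 // ltW.
  rewrite vn; apply: (@le_trans _ _ (k * B)); first by rewrite ler_pM ?sqrtr_ge0.
  by rewrite /k divfK ?gt_eqF // mulrC ler_wpM2r // ltW.
have Qyr : `|Q j + y - p| < r2.
  by rewrite addrAC (le_lt_trans (ler_normD _ _)) //; lra.
have [r2r r2r1] : r2 <= r /\ r2 <= r1 by rewrite !ge_min !lexx orbT.
have Dy : D (Q j + y).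
  apply: (Hr1 _ _).2; first by apply: lt_le_trans Qyr _.
  have := Hr j s v y l0 b0 erefl _ (lt_le_trans Qyr r2r).
  rewrite -/b => /(_ ltac:(lra)).
  rewrite ler_norml => /andP[_ T].
  have HB2 : e * `|v *m nu j| ^+ 2 <= - S al mu_ nu_ s v / 2.
    apply: (@le_trans _ _ (e * B ^+ 2)).
      by rewrite ler_wpM2l ?(ltW e0) // !expr2 ler_pM.
    by rewrite /e le_eqVlt; apply/orP; left; apply/eqP; field; rewrite gt_eqF.
  have k1 : 0 < (lam j)^-1 * b ^+ 2 by rewrite mulr_gt0 ?invr_gt0 // exprn_even_gt0.
  by rewrite -(pmulr_rlt0 _ k1); lra.
have [def _ _ surj] := aut j.
have [x Dx xE] := surj _ Dy.
pose u := x - q; have xu : x = q + u by rewrite addrC subrK.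
have au := (normal j u).1.1; rewrite -xu in au.
have {}au := au (def _ Dx).
have := (normal j u).2 au; rewrite -xu xE => /addrI yE.
pose kap := b / (1 + lf (alpha j) u).
have vu : v = kap *: u.
  apply/eqP; rewrite -subr_eq0; apply/eqP/(@eta_inj j).
  rewrite mulmxBl -scalemxAl /kap -scalerA -yE /y scalerA mulfV //.
  by rewrite scale1r subrr.
have sk : s = kap.
  have E : b = kap * (1 + lf (alpha j) u) by rewrite /kap divfK.
  by move: E; rewrite /b {1}vu lfZ; lra.
have s0 : s != 0 by rewrite sk mulf_neq0 // invr_eq0.
split=> //.
by rewrite vu -sk scalerA mulVf // scale1r -xu.
Unshelve. all: by end_near. Qed.

(** Completing the square in [s + lf al v] writes [S] as [qf P v] minus the square of
    [s + lf (al - 2^-1 *: mu_) v]; [no_line] excludes degenerate directions of [P]. *)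
Lemma proj_equiv_ball_of_limit : proj_equiv_ball D.
Proof.
have [N N0 HN] := finsler convex_p.
pose P : 'M[R]_d := 4^-1 *: (mu_ *m mu_^T) + 2^-1 *: (nu_ *m H *m nu_^T).
have PE v : qf P v = lf mu_ v ^+ 2 / 4 + qf H (v *m nu_) / 2.
  have addE (A B : 'M[R]_1) : (A + B) 0 0 = A 0 0 + B 0 0 by rewrite mxE.
  have scE a (A : 'M[R]_1) : (a *: A) 0 0 = a * A 0 0 by rewrite mxE.
  rewrite /qf /P mulmxDr mulmxDl addE -!scalemxAr -!scalemxAl !scE.
  rewrite trmx_mul !mulmxA ![_ / _]mulrC; congr (_ * _ + _).
  rewrite -(mulmxA (v *m mu_)) -trmx_mul [LHS]mxE big_ord1 [X in _ * X]mxE.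
  by rewrite expr2.
have SE s v : S al mu_ nu_ s v =
    qf P v - (s + lf (al - 2^-1 *: mu_) v) ^+ 2.
  by rewrite PE lfBl lfZl /S; field.
have posP v : v != 0 -> 0 < qf P v.
  move=> v0; rewrite ltNge; apply/negP => P0; move: v0; apply/negP/negPn/eqP.
  have n0 : 0 <= `|v *m nu_| ^+ 2 / N by rewrite divr_ge0 ?exprn_ge0 // ltW.
  have := HN (v *m nu_); rewrite nu_tangent expr0n mulr0 addr0 -/H => Hn.
  have m0 := sqr_ge0 (lf mu_ v).
  rewrite PE in P0.
  have q0 : qf H (v *m nu_) = 0 by lra.
  have mv : lf mu_ v = 0 by apply/eqP; rewrite -sqrf_eq0; apply/eqP; lra.
  (* In a degenerate direction [S] reduces to [- (s + t * lf al v) ^+ 2]. The case [s = 0] forces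
     [lf al v = 0], and then [s = 1] yields a whole line in [D]. *)
  have cone (s t : R) : s + t * lf al v != 0 ->
      s != 0 /\ D (q + s^-1 *: (t *: v)).
    move=> st; apply: quadric_sub_D.
    rewrite SE PE -scalemxAl qfZ q0 lfZ lfBl !lfZl !lfZ mv.
    rewrite !mulr0 subr0 expr0n !mul0r addr0 add0r oppr_lt0.
    by rewrite exprn_even_gt0.
  have av : lf al v = 0.
    apply/eqP/negPn/negP => av; have [] := cone 0 1 _; last by rewrite eqxx.
    by rewrite add0r mul1r.
  apply: no_line => t; have [|_] := cone 1 t; last by rewrite invr1 scale1r.
  by rewrite av mulr0 addr0 oner_neq0.
have [M HM] := posdef_sum_squares posP.
apply: (@proj_equiv_ball_of_quadric R d D q (al - 2^-1 *: mu_) M).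
- exact: oD.
- by move=> v /D_sub_quadric; rewrite SE -HM subr_le0.
- by move=> s v; rewrite -HM -subr_lt0 -SE; exact: quadric_sub_D.
- move=> v vM; apply/eqP/negPn/negP => /posP; rewrite HM vM /sqn big1 ?ltxx //.
  by move=> i _; rewrite mxE expr0n.
Qed.


End limit.
End scaling.

Theorem theorem4 (R : realType) (d : nat) (D : set 'rV[R]_d)
    (p q : 'rV[R]_d) (phi : nat -> 'M[R]_(1 + d)) :
  domain D ->
  boundary D p -> D q ->
  (forall j, proj_aut D (phi j)) ->
  proj_map (phi j) q @[j --> \oo] --> p ->
  strictly_convex_point D p ->
  proj_equiv_ball D.
Proof.
move=> [oD cD _] [_ nDp] Dq aut qp [_ [U [rho [[oU Up C2 DU _] convex]]]].
have {}nDp : ~ D p by move=> Dp; apply: nDp; exact: open_nbhs_nbhs.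
have convex_p (v : 'rV[R]_d) : v != 0 -> lf (grad rho p) v = 0 ->
    0 < qf (hess rho p) v.
  move=> v0 gv; have -> : qf (hess rho p) v =
      \sum_i \sum_j v 0 i * v 0 j * pd i (pd j rho) p.
    by rewrite qfE; apply: eq_bigr => i _; apply: eq_bigr => j _; rewrite mxE.
  apply: convex => //; rewrite -[RHS]gv lfE.
  by apply: eq_bigr => i _; rewrite mxE.
have cvg_p := aut_cvg oD aut (short_near_p oU Up C2 DU convex_p nDp) cD Dq qp.
have nf j : exists ae : 'cV[R]_d * 'M[R]_d, forall v : 'rV[R]_d,
    (proj_defined (phi j) (q + v) <-> 1 + lf ae.1 v != 0) /\
    (1 + lf ae.1 v != 0 -> proj_map (phi j) (q + v) =
      proj_map (phi j) q + (1 + lf ae.1 v)^-1 *: (v *m ae.2)).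
  have [def _ _ _] := aut j.
  have [alpha [eta H]] := proj_normal_form (def _ Dq).
  by exists (alpha, eta).
have [ae Hae] := choice nf.
have [G [GU sG]] := ultraFilterLemma (@eventually_filter : ProperFilter \oo).
have [al [mu [nu lim]]] := scaling_limit oU Up C2 DU convex_p oD nDp Dq aut cvg_p
  Hae GU sG.
exact: (proj_equiv_ball_of_limit oU Up C2 DU convex_p oD nDp Dq aut cvg_p
  Hae GU sG lim).
Qed.
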